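(* The Hilbert--Stieltjes integral $\mathbb H_\Phi(\tau)$ converges (i.e. the defining principal-value limit exists and is finite) for a.e. $\tau\in\mathbb R$, for every $2\pi$-periodic bounded function $\Phi:\mathbb R\to\mathbb R$ that is differentiable a.e.
   Context: For arbitrary functions $g,f$ on a compact interval $[a,b]$, the Riemann--Stieltjes integral $\int_a^b g\,df$ is the limit, as $\delta:=\max_k|t_k-t_{k-1}|\to0$, of the sums $\sum_{k=1}^p g(\tau_k)\,(f(t_k)-f(t_{k-1}))$ over partitions $a=t_0\le t_1\le\dots\le t_p=b$ and points $\tau_k\in[t_{k-1},t_k]$, provided a finite limit exists, uniform with respect to the partitions and the intermediate points (no monotonicity or bounded variation is assumed). The Hilbert--Stieltjes integral of $\Phi$ at $\tau$ is the principal value $$\mathbb H_\Phi(\tau):=\frac1{2\pi}\lim_{\varepsilon\to+0}\int_{\varepsilon\le|\tau-t|\le\pi}\frac{d\Phi(t)}{\tan\frac{\tau-t}{2}},$$ where the integral is the sum of the Riemann--Stieltjes integrals over $[\tau-\pi,\tau-\varepsilon]$ and $[\tau+\varepsilon,\tau+\pi]$, and $1/\tan(\pm\pi/2)$ is read as $\cot(\pm\pi/2)=0$. *)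

(* Defs.v *)
From mathcomp Require Import all_boot all_order all_algebra.
From mathcomp Require Import all_classical all_reals all_analysis.

Set Implicit Arguments.
Unset Strict Implicit.
Unset Printing Implicit Defensive.

Import Order.TTheory GRing.Theory Num.Theory.
Import numFieldNormedType.Exports.

Local Open Scope classical_set_scope.
Local Open Scope ring_scope.

Section RiemannStieltjes.
Context {R : realType}.
Implicit Types (g f Phi : R -> R) (a b I tau : R).

(* Only the values t_0, ..., t_p and s_0, ..., s_(p-1) matter; s_k is the
   intermediate point of [t_k, t_(k+1)].  The points t_k may coincide. *)
Definition tagged_partition a b (p : nat) (t s : nat -> R) : Prop :=
  [/\ t 0%N = a, t p = b &
      forall k, (k < p)%N -> t k <= s k /\ s k <= t k.+1].

Definition rs_sum g f (p : nat) (t s : nat -> R) : R :=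
  \sum_(0 <= k < p) g (s k) * (f (t k.+1) - f (t k)).

(* I is the limit of the sums as the mesh tends to 0 (not along refinements),
   for arbitrary real functions g and f. *)
Definition is_rs_integral g f a b I : Prop :=
  forall e : R, 0 < e -> exists2 d : R, 0 < d &
    forall (p : nat) (t s : nat -> R), tagged_partition a b p t s ->
      (forall k, (k < p)%N -> t k.+1 - t k < d) ->
      `|rs_sum g f p t s - I| < e.

(* At t = tau - pi and t = tau + pi the tangent is a division by 0, hence 0,
   and so is its inverse: this is cot (+- pi / 2) = 0, see [hs_kernelE]. *)
Definition hs_kernel tau (t : R) : R := (tan ((tau - t) / 2))^-1.

Lemma hs_kernelE tau t :
  hs_kernel tau t = cos ((tau - t) / 2) / sin ((tau - t) / 2).
Proof. by rewrite /hs_kernel /tan invf_div. Qed.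

Definition is_truncated_hs Phi tau (eps I : R) : Prop :=
  exists I1 I2 : R,
    [/\ is_rs_integral (hs_kernel tau) Phi (tau - pi) (tau - eps) I1,
        is_rs_integral (hs_kernel tau) Phi (tau + eps) (tau + pi) I2 &
        I = I1 + I2].

(* h is the value at tau of the Hilbert-Stieltjes integral of Phi; the
   truncated integrals are themselves required to exist. *)
Definition is_hilbert_stieltjes Phi tau (h : R) : Prop :=
  exists2 J : R -> R,
    (forall eps, 0 < eps < pi -> is_truncated_hs Phi tau eps (J eps)) &
    (2 * pi)^-1 * J eps @[eps --> 0^'+] --> h.

Definition hilbert_stieltjes_converges Phi tau : Prop :=
  exists h : R, is_hilbert_stieltjes Phi tau h.

End RiemannStieltjes.

(* Main.v *)
Require Import Defs.
From mathcomp Require Import all_boot all_order all_algebra.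
From mathcomp Require Import all_classical all_reals all_analysis.
From mathcomp Require Import measurable_realfun ring lra.

(* Let E_n be the set of x with |Phi y - Phi x| <= n |y - x| for all y.  It is
   closed, and since Phi is bounded the E_n cover the points where Phi is
   differentiable.  Let G be a 2 pi-periodic n-Lipschitz function equal to Phi on
   E_n, and phi a measurable version of Phi.  Integrating by parts, at a point tau
   of E_n where Phi is differentiable the truncated integrals are, up to
     cot (e / 2) (Phi (tau + e) + Phi (tau - e) - 2 Phi tau) -> 0,
   the integrals of (phi t - Phi tau) / (1 - cos (t - tau)) over
   e <= |t - tau| <= pi, with a minus sign.  Split phi = G + (phi - G).

   The part of phi - G converges absolutely at a.e. tau in E_n: |phi t - G t| is
   at most 2 n times the distance from t to E_n (Marcinkiewicz).

   For the part of G, put E y = G (tau + y) + G (tau - y) - 2 G tau and let H be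
   2 pi times the conjugate function of G.  Then
     (H (tau + e) - H (tau - e)) / (2 sin e)
   is the integral over [0, pi] of (E y - E e) / (cos y - cos e), and it differs
   by o(1) from minus the integral of E y / (1 - cos y) over [2 e, pi], so that
   the truncated integrals converge wherever G and H are differentiable.  This
   holds a.e. for H by an L^2 argument: a discrete Hilbert inequality bounds the
   sums of squared increments of H on dyadic grids. *)

Import Order.TTheory GRing.Theory Num.Theory.
Import numFieldNormedType.Exports.

Local Open Scope classical_set_scope.
Local Open Scope ring_scope.

Set Implicit Arguments.
Unset Strict Implicit.
Unset Printing Implicit Defensive.

(** * Integrals over intervals *)

Section interval_integrals.
Context {R : realType}.
Notation mu := (@lebesgue_measure R).
Implicit Types (f g : R -> R) (a b c C : R).

(** [Phi] is arbitrary and may fail to be measurable, so that at the outset neither its Lebesgue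
    integral nor the convergence of the Stieltjes sums is available. After summation by parts the
    differences fall on the smooth kernel, and [Phi] is only evaluated at tags. A tag close to a
    point x of E_n has a value close to Phi x, whatever [Phi] does elsewhere, and the complement of
    E_n in an interval has small measure for large n. This one-sided comparison is all that the
    integral needs. The part of G cannot be treated by absolute values: differentiability gives only
    E y = o(y) against a weight of order y^-2. The cancellation is read off from H. Its dyadic
    difference quotients form a martingale, and the discrete Hilbert inequality bounds it in L^2, so
    that H is an indefinite integral; neither Fourier series nor maximal functions enter. The
    comparison with H cuts at 2 e, not at e, because (E y - E e) / (cos y - cos e) has a denominator
    vanishing at y = e: the interval [0, 2 e] around that point is estimated separately. *)

Lemma bounded_integrable_itv f a b C : measurable_fun `[a, b] f ->
  (forall x, a <= x <= b -> `|f x| <= C) -> mu.-integrable `[a, b] (EFin \o f).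
Proof.
move=> mf fC; apply: measurable_bounded_integrable => //.
  by rewrite /= lebesgue_measure_itv/=; case: ifPn => _; rewrite ?ltry// -EFinB ltry.
exists C; split; first exact: num_real.
by move=> D CD x /=; rewrite in_itv/= => /fC /le_trans; apply; exact: ltW.
Qed.

Lemma Rintegral_itv_cst a b C : a <= b ->
  \int[mu]_(x in `[a, b]) C = C * (b - a).
Proof.
move=> ab; rewrite Rintegral_cst//= lebesgue_measure_itv/= lte_fin.
case: ltP => //= ba; rewrite (_ : a = b) ?subrr//.
by apply/eqP; rewrite eq_le ab.
Qed.

Lemma integrable_itv_cst a b C : mu.-integrable `[a, b] (EFin \o cst C).
Proof.
apply: (@bounded_integrable_itv _ _ _ `|C|) => //.
Qed.

Lemma normr_Rintegral_itv_le f a b C : a <= b ->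
  measurable_fun `[a, b] f -> (forall x, a <= x <= b -> `|f x| <= C) ->
  `|\int[mu]_(x in `[a, b]) f x| <= C * (b - a).
Proof.
move=> ab mf fC; have intf := bounded_integrable_itv mf fC.
rewrite (le_trans (le_normr_Rintegral _ _))// -(Rintegral_itv_cst _ ab).
apply: le_Rintegral => //.
- exact: (integrable_norm intf).
- exact: integrable_itv_cst.
Qed.

Lemma Rintegral_itv_split f a b c : a <= c <= b ->
  mu.-integrable `[a, b] (EFin \o f) ->
  \int[mu]_(x in `[a, b]) f x =
  \int[mu]_(x in `[a, c]) f x + \int[mu]_(x in `[c, b]) f x.
Proof.
move=> /andP[ac cb] intf.
have /(_ _ _)/eqP := @Rintegral_itvB _ f (BLeft a) (BRight b) c intf.
rewrite !bnd_simp => /(_ ac cb); rewrite subr_eq addrC => /eqP ->//.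
rewrite Rintegral_itv_obnd_cbnd//; apply: integrableS intf => //.
by apply: subset_itvr; rewrite bnd_simp.
Qed.

Lemma integrable_itvS f a b a' b' : a <= a' -> b' <= b ->
  mu.-integrable `[a, b] (EFin \o f) -> mu.-integrable `[a', b'] (EFin \o f).
Proof.
move=> aa bb; apply: integrableS => //.
by apply: subset_itv; rewrite bnd_simp.
Qed.

Lemma integrable_mulrl (D : set R) f c : measurable D ->
  mu.-integrable D (EFin \o f) -> mu.-integrable D (EFin \o (fun x => c * f x)).
Proof.
move=> mD intf; have := integrableZl _ c intf.
by apply.
Qed.

Lemma integrable_addr (D : set R) f g : measurable D ->
  mu.-integrable D (EFin \o f) -> mu.-integrable D (EFin \o g) ->
  mu.-integrable D (EFin \o (fun x => f x + g x)).
Proof.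
move=> mD intf intg; have := integrableD _ intf intg.
by apply.
Qed.

Lemma integrable_subr (D : set R) f g : measurable D ->
  mu.-integrable D (EFin \o f) -> mu.-integrable D (EFin \o g) ->
  mu.-integrable D (EFin \o (fun x => f x - g x)).
Proof.
move=> mD intf intg; have := integrableB _ intf intg.
by apply.
Qed.

(** Image measures give the formula for nonnegative functions. It is applied to the positive and the
    negative part, so that [f] may fail to be integrable. *)
Lemma integral_measure_preserving (phi : R -> R) (D : set R) f :
  measurable_fun setT phi ->
  (forall A, measurable A -> mu (phi @^-1` A) = mu A) ->
  measurable D -> measurable_fun setT f ->
  \int[mu]_(x in D) f x = \int[mu]_(x in phi @^-1` D) f (phi x).
Proof.
move=> mphi phiE mD mf; rewrite /Rintegral; congr fine.
have push (g : R -> \bar R) : measurable_fun setT g -> (forall x, (0 <= g x)%E) ->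
   (\int[mu]_(x in D) g x = \int[mu]_(x in phi @^-1` D) (g \o phi) x)%E.
  move=> mg g0.
  transitivity (\int[pushforward mu (phi : _ -> measurableTypeR R)]_(x in D) g x)%E.
    by apply: eq_measure_integral => //= A mA AS; rewrite /pushforward phiE.
  by apply: ge0_integral_pushforward => //; exact: measurable_funS mg.
rewrite integralE [RHS]integralE push//; last first.
  by apply/measurable_funepos/measurable_EFinP.
rewrite [X in (_ - X)%E]push//.
  by congr (_ - _)%E; apply: eq_integral => x _ /=; rewrite ?funeposE ?funenegE.
by apply/measurable_funeneg/measurable_EFinP.
Qed.

Lemma lebesgue_measureD c (A : set R) : measurable A ->
  mu ((fun x => x + c) @^-1` A) = mu A.
Proof.
move=> mA; pose phi : R -> measurableTypeR R := fun x => x + c.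
have mphi : measurable_fun setT phi by apply: measurable_funD.
rewrite -[LHS]/(pushforward mu phi A).
apply/esym/lebesgue_measure_unique => //= _ [[a b]] _ <-.
rewrite /pushforward (_ : _ @^-1` _ = `]a - c, b - c]%classic).
  by rewrite !lebesgue_measure_itv/= !lte_fin ltrD2r -!EFinB opprB addrA subrK.
by apply/seteqP; split => x /=; rewrite !in_itv/= ltrBlDr lerBrDr.
Qed.

Lemma Rintegral_translation f a b c : measurable_fun setT f ->
  \int[mu]_(x in `[a, b]) f x = \int[mu]_(x in `[a - c, b - c]) f (x + c).
Proof.
move=> mf; rewrite (@integral_measure_preserving (fun x => x + c))//.
- congr (Rintegral _ _ _); apply/seteqP; split => x /=; rewrite !in_itv/=.
    by rewrite lerBlDr lerBrDr.
  by rewrite lerBlDr lerBrDr.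
- exact: measurable_funD.
- exact: lebesgue_measureD.
Qed.

Lemma Rintegral_reflection f a b : measurable_fun setT f ->
  \int[mu]_(x in `[a, b]) f x = \int[mu]_(x in `[- b, - a]) f (- x).
Proof.
move=> mf; rewrite (@integral_measure_preserving -%R)//.
- congr (Rintegral _ _ _); apply/seteqP; split => x /=; rewrite !in_itv/=.
    by rewrite lerNr andbC lerNl.
  by rewrite lerNr andbC lerNl.
- exact: lebesgue_measureN.
Qed.

Lemma Rintegral_periodic f T c C : 0 <= T -> 0 <= c <= T -> periodic f T ->
  measurable_fun setT f -> (forall x, `|f x| <= C) -> forall a,
  \int[mu]_(x in `[a + c, a + c + T]) f x = \int[mu]_(x in `[a, a + T]) f x.
Proof.
move=> T0 /andP[c0 cT] pf mf fC a.
have intf u v : mu.-integrable `[u, v] (EFin \o f).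
  by apply: (@bounded_integrable_itv _ _ _ C) => //; exact: measurable_funS mf.
(* The piece beyond a + T is the translate by T of the piece before a + c. *)
rewrite (@Rintegral_itv_split _ _ _ (a + T))//; last by apply/andP; split; lra.
rewrite [RHS](@Rintegral_itv_split _ _ _ (a + c))//; last by apply/andP; split; lra.
rewrite addrC; congr (_ + _).
rewrite (@Rintegral_translation _ _ _ T)// addrK (_ : a + c + T - T = a + c) ?addrK//.
by apply: eq_Rintegral => x _; rewrite pf.
Qed.

End interval_integrals.

Section measurable_kernel.
Context {R : realType}.

(** The inverse is continuous off 0, and {0} is a measurable singleton. *)
Lemma invr_measurable : measurable_fun setT (@GRing.inv R).
Proof.
rewrite -(setUv [set 0 : R]); apply/measurable_funU => //.
  exact: measurableC.
split; first exact: measurable_fun_set1.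
apply: subspace_continuous_measurable_fun; first exact: measurableC.
apply: continuous_in_subspaceT => x /set_mem/= /eqP x0.
exact: inv_continuous.
Qed.

Lemma measurable_funV (f : R -> R) (D : set R) :
  measurable_fun D f -> measurable_fun D (fun x => (f x)^-1).
Proof. by move=> mf; exact: measurableT_comp invr_measurable mf. Qed.

End measurable_kernel.

Section lebesgue_ae.
Context {R : realType}.
Notation mu := (@lebesgue_measure R).
Implicit Types P Q : R -> Prop.

Lemma lebesgue_aeS P Q : {ae mu, forall x, P x} -> (forall x, P x -> Q x) ->
  {ae mu, forall x, Q x}.
Proof. by move=> aeP PQ; apply: negligibleS aeP => x /= nQ /PQ. Qed.

Lemma lebesgue_aeI P Q : {ae mu, forall x, P x} -> {ae mu, forall x, Q x} ->
  {ae mu, forall x, P x /\ Q x}.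
Proof.
move=> aeP aeQ; have := negligibleU aeP aeQ; apply: negligibleS => x /= nPQ.
by apply: contrapT => /not_orP[/contrapT Px /contrapT Qx]; exact: nPQ.
Qed.

End lebesgue_ae.

Lemma measurable_le_set d (T : measurableType d) {R : realType} (f g : T -> R) :
  measurable_fun setT f -> measurable_fun setT g ->
  measurable [set x | f x <= g x].
Proof.
move=> mf mg; have := measurable_fun_ler mf mg measurableT (I : measurable [set true]).
rewrite setTI; congr (measurable _).
Qed.

(** * A discrete Hilbert inequality *)

Section discrete_hilbert.
Context {R : realType}.
Implicit Types (f v G : R -> R) (N n : nat) (t x z : R).

(** This is cot (t / 2), with the value 0 at the multiples of 2 pi, where the division is by 0. *)
Definition kap t : R := cos (t / 2) / sin (t / 2).

Lemma kapN t : kap (- t) = - kap t.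
Proof. by rewrite /kap mulNr cosN sinN invrN mulrN. Qed.

Lemma kapD2pi : periodic (@kap) (2 * pi).
Proof.
move=> t; rewrite /kap mulrDl (mulrC 2) mulfK ?pnatr_eq0//.
by rewrite sinDpi cosDpi invrN mulrNN.
Qed.

Lemma kapM a b : sin (a / 2) != 0 -> sin (b / 2) != 0 ->
  sin ((a - b) / 2) != 0 ->
  kap a * kap b = kap (a - b) * (kap b - kap a) - 1.
Proof.
rewrite /kap mulrBl sinB cosB.
by move=> a0 b0 ab0; field; rewrite a0 b0 ab0.
Qed.

Definition psum f N z : R := \sum_(0 <= j < N) f (z + 2 * pi / N%:R * j%:R).

Lemma psum_shift f N z : (0 < N)%N -> periodic f (2 * pi) ->
  psum f N (z + 2 * pi / N%:R) = psum f N z.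
Proof.
case: N => // n _ pf; rewrite /psum big_nat_recr//= big_nat_recl//= addrC.
congr (_ + _).
  rewrite mulr0 addr0 -[RHS]pf; congr f.
  rewrite -[in RHS](@divfK _ n.+1%:R _ (2 * pi)) ?pnatr_eq0//.
  by set d := _ / _; rewrite -(natr1 n); ring.
apply: eq_big_nat => i _; congr (f _); rewrite -[in RHS]natr1; ring.
Qed.

Lemma psum_shiftn f N z i : (0 < N)%N -> periodic f (2 * pi) ->
  psum f N (z + 2 * pi / N%:R * i%:R) = psum f N z.
Proof.
move=> N0 pf; elim: i => [|i IH]; first by rewrite mulr0 addr0.
rewrite -IH -[RHS]psum_shift// -natr1; congr psum; ring.
Qed.

Lemma psum_rev f N z : (0 < N)%N ->
  psum f N z =
  \sum_(0 <= j < N) f (z + 2 * pi - 2 * pi / N%:R - 2 * pi / N%:R * j%:R).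
Proof.
case: N => // n _; rewrite /psum big_nat_rev/=.
apply: eq_big_nat => i /andP[_ iN]; congr (f _).
rewrite add0n subSS natrB//; rewrite -(natr1 n).
by field; rewrite natr1 pnatr_eq0.
Qed.

(** The grid of midpoints is symmetric under t -> 2 pi - t, and [kap] is odd and periodic; hence the
    sum is its own opposite. *)
Lemma psum_kap0 N i : (0 < N)%N ->
  psum kap N (2 * pi / N%:R / 2 - 2 * pi / N%:R * i%:R) = 0.
Proof.
move=> N0; rewrite -(@psum_shiftn _ _ _ i)//; last exact: kapD2pi.
rewrite subrK; suff : psum kap N (2 * pi / N%:R / 2) *+ 2 = 0.
  by move=> /eqP; rewrite mulrn_eq0 => /eqP.
rewrite mulr2n {2}psum_rev// /psum -big_split/= big1_seq// => j _.
rewrite -[X in kap X + _]opprK kapN -[X in - X + _]kapD2pi; apply/eqP.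
by rewrite addrC subr_eq0; apply/eqP; congr kap; lra.
Qed.

Let c N (i l : nat) : R := kap (2 * pi / N%:R * (i%:R - l%:R - 2^-1)).

Let sin_half_neq0 N (r : R) : (0 < N)%N -> r != 0 -> `|r| < N%:R ->
  sin (2 * pi / N%:R * r / 2) != 0.
Proof.
move=> N0 r0 rN; have N0' : 0 < N%:R :> R by rewrite ltr0n.
rewrite (_ : _ / 2 = pi / N%:R * r); last by field; rewrite gt_eqF.
have pN : 0 < pi / N%:R :> R by rewrite divr_gt0// pi_gt0.
have rpi : `|pi / N%:R * r| < pi.
  by rewrite normrM gtr0_norm// mulrAC ltr_pdivrMr// ltr_pM2l// pi_gt0.
have [r1|r1] := ltP 0 r.
  rewrite gt_eqF// sin_gt0_pi// mulr_gt0//=.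
  by apply: le_lt_trans rpi; rewrite ler_norm.
have {r1} r1 : r < 0 by rewrite lt_neqAle r0.
rewrite -oppr_eq0 -sinN gt_eqF// sin_gt0_pi// -mulrN mulr_gt0 ?oppr_gt0//=.
by apply: le_lt_trans rpi; rewrite mulrN -normrN ler_norm.
Qed.

Let sumc1 N l : (0 < N)%N -> (l < N)%N -> \sum_(0 <= i < N) c N i l = 0.
Proof.
move=> N0 lN.
rewrite -[RHS](@psum_kap0 N l.+1 N0) /psum; apply: eq_big_nat => i _.
by rewrite /c; congr kap; rewrite -(natr1 l); field; rewrite pnatr_eq0 -lt0n.
Qed.

Let sumc2 N i : (0 < N)%N -> \sum_(0 <= l < N) c N i l = 0.
Proof.
move=> N0; apply/eqP; rewrite -oppr_eq0 -sumrN; apply/eqP.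
rewrite -[RHS](@psum_kap0 N i N0) /psum; apply: eq_big_nat => l _.
by rewrite /c -kapN; congr kap; field; rewrite pnatr_eq0 -lt0n.
Qed.

Let half_int_neq0 (i l : nat) : i%:R - l%:R - 2^-1 != 0 :> R.
Proof.
rewrite subr_eq0; apply/eqP => /(congr1 (fun x => 2 * x)).
rewrite mulrBr mulfV ?pnatr_eq0// => h.
have /eqP : (2 * i)%:R = (2 * l).+1%:R :> R by rewrite -natr1 !natrM; lra.
by rewrite eqr_nat => /eqP /(congr1 odd); rewrite oddS !mul2n !odd_double.
Qed.

Let half_int_lt N (i l : nat) : (i < N)%N -> (l < N)%N ->
  `|i%:R - l%:R - 2^-1| < N%:R :> R.
Proof.
move=> iN lN; have : i%:R + 1 <= N%:R :> R by rewrite natr1 ler_nat.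
have : l%:R + 1 <= N%:R :> R by rewrite natr1 ler_nat.
have : 0 <= i%:R :> R by []. have : 0 <= l%:R :> R by [].
by rewrite ltr_norml => *; apply/andP; split; lra.
Qed.

Let gram N l m : (0 < N)%N -> (l < N)%N -> (m < N)%N -> l != m ->
  \sum_(0 <= i < N) c N i l * c N i m = - N%:R.
Proof.
move=> N0 lN mN lm.
have lm0 : m%:R - l%:R != 0 :> R by rewrite subr_eq0 eqr_nat eq_sym.
have lmN : `|m%:R - l%:R| < N%:R :> R.
  have : m%:R + 1 <= N%:R :> R by rewrite natr1 ler_nat.
  have : l%:R + 1 <= N%:R :> R by rewrite natr1 ler_nat.
  have : 0 <= m%:R :> R by []. have : 0 <= l%:R :> R by [].
  by rewrite ltr_norml => *; apply/andP; split; lra.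
transitivity (\sum_(0 <= i < N)
   (kap (2 * pi / N%:R * (m%:R - l%:R)) * (c N i m - c N i l) - 1)).
  apply: eq_big_nat => i /andP[_ iN]; rewrite /c kapM ?sin_half_neq0 ?half_int_lt//.
    by congr (kap _ * _ - _); ring.
  rewrite -mulrBr (_ : _ - _ - (_ - _) = m%:R - l%:R); last by ring.
  exact: sin_half_neq0.
rewrite big_split/= -mulr_sumr big_split/= sumrN !sumc1// subrr mulr0 add0r.
by rewrite sumrN big_const_nat subn0 iter_addr addr0.
Qed.

(* The Gram matrix of the columns of [c N] is N^2 I - N J with J the all-ones
   matrix: off the diagonal by cot a cot b = cot (a - b) (cot b - cot a) - 1,
   and on the diagonal because the rows sum to 0. *)
Lemma discrete_hilbert N (v : nat -> R) : (0 < N)%N ->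
  \sum_(0 <= i < N) (\sum_(0 <= l < N)
    v l * kap (2 * pi / N%:R * (i%:R - l%:R - 2^-1))) ^+ 2 <=
  N%:R ^+ 2 * \sum_(0 <= l < N) v l ^+ 2.
Proof.
move=> N0; rewrite -/(c N).
pose g l m := \sum_(0 <= i < N) c N i l * c N i m.
have gE l m : (l < N)%N -> (m < N)%N ->
    g l m = (l == m)%:R * N%:R ^+ 2 - N%:R.
  move=> lN mN; have [<-{m mN}|lm] := eqVneq l m; last by rewrite /g gram// mul0r sub0r.
  have : \sum_(0 <= m < N) g l m = 0.
    rewrite /g exchange_big/= big1_seq// => i _.
    by rewrite -mulr_sumr sumc2// mulr0.
  rewrite big_mkord (bigD1 (Ordinal lN))//=.
  rewrite (eq_bigr (fun=> - N%:R)); last first.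
    by move=> [m mN]/= ml; rewrite /g gram// eq_sym.
  rewrite sumrN sumr_const cardC1 card_ord -[_ *+ N.-1]mulr_natr => /eqP.
  rewrite subr_eq0 => /eqP ->; rewrite -[in RHS](prednK N0) -[in LHS](prednK N0).
  by rewrite -natr1 /=; ring.
rewrite [leLHS](_ : _ = \sum_(0 <= l < N) \sum_(0 <= m < N) v l * v m * g l m).
  under eq_big_nat => l /andP[_ lN].
    under eq_big_nat => m /andP[_ mN].
      rewrite gE// mulrBr; over.
    rewrite big_split/= sumrN big_mkord (bigD1 (Ordinal lN))//= eqxx mul1r.
    rewrite big1 ?addr0; last first.
      by move=> [m mN] /=; rewrite -val_eqE/= eq_sym => /negPf ->; rewrite mul0r mulr0.
    rewrite -mulr_suml -mulr_sumr.
    over.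
  (* The all-ones part of the Gram matrix contributes - N times the square of the sum of v, and is
     dropped. *)
  rewrite big_split/= -mulr_suml sumrN -mulr_suml -mulr_suml -expr2.
  under [X in _ <= _ * X]eq_bigr do rewrite expr2.
  by rewrite mulrC gerDl oppr_le0 mulr_ge0// sqr_ge0.
under eq_big_nat => i _ do rewrite expr2 mulr_suml.
rewrite exchange_big/=; apply: eq_big_nat => l _.
under eq_big_nat => i _ do rewrite mulr_sumr.
rewrite exchange_big/=; apply: eq_big_nat => m _.
by rewrite /g mulr_sumr; apply: eq_big_nat => i _; exact: mulrACA.
Qed.

End discrete_hilbert.

(** * Midpoint sums for the conjugate function *)

Section conjugate_sums.
Context {R : realType}.
Implicit Types (G : R -> R) (N m r : nat) (c x M : R).

(* The midpoint sums avoid the pole of [kap] at 0. *)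
Definition conj_sum G N x : R :=
  2 * pi / N%:R * psum (fun t => G (x - t) * kap t) N (2 * pi / N%:R / 2).

(** By periodicity the grid can be shifted by i steps and reversed, after which the arguments of [G]
    no longer depend on i: the sums are the matrix of [discrete_hilbert] applied to a fixed
    vector. *)
Lemma conj_sumE G N c i : (0 < N)%N -> periodic G (2 * pi) ->
  conj_sum G N (c + 2 * pi / N%:R * i%:R) =
  2 * pi / N%:R * \sum_(0 <= l < N) G (c + 2 * pi / N%:R * (l%:R + 2^-1)) *
     kap (2 * pi / N%:R * (i%:R - l%:R - 2^-1)).
Proof.
move=> N0 pG; rewrite /conj_sum; congr (_ * _); set f := fun t => _.
have pf : periodic f (2 * pi).
  move=> t; rewrite /f kapD2pi; congr (_ * _); rewrite -[LHS]pG; congr G; ring.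
rewrite -(@psum_shiftn _ _ _ _ i)// psum_rev//; apply: eq_big_nat => j _.
rewrite (_ : _ - _ * j%:R = 2 * pi / N%:R * (i%:R - j%:R - 2^-1) + 2 * pi).
  rewrite pf /f; congr (G _ * _); ring.
by field; rewrite pnatr_eq0 -lt0n.
Qed.

(** The increments of the sums are the sums for the increments of [G], each at most 2 pi M / N in
    absolute value. The constant is (2 pi / N)^2 N^2 N (2 pi M / N)^2. *)
Lemma conj_sum_diff G N c M : (0 < N)%N -> periodic G (2 * pi) ->
  (forall x y, `|G x - G y| <= M * `|x - y|) ->
  \sum_(0 <= i < N) (conj_sum G N (c + 2 * pi / N%:R * i.+1%:R) -
                     conj_sum G N (c + 2 * pi / N%:R * i%:R)) ^+ 2 <=
  16 * pi ^+ 4 * M ^+ 2 / N%:R.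
Proof.
move=> N0 pG GM; have N0' : 0 < N%:R :> R by rewrite ltr0n.
pose v l := G (c + 2 * pi / N%:R + 2 * pi / N%:R * (l%:R + 2^-1)) -
            G (c + 2 * pi / N%:R * (l%:R + 2^-1)).
have d0 : 0 <= 2 * pi / N%:R :> R by rewrite divr_ge0 ?mulr_ge0 ?pi_ge0// ltW.
have vM l : v l ^+ 2 <= (M * (2 * pi / N%:R)) ^+ 2.
  rewrite -real_normK ?num_real// lerXn2r ?nnegrE//.
    apply: (le_trans (normr_ge0 (G 0 - G (2 * pi / N%:R)))).
    by rewrite (le_trans (GM _ _))// sub0r normrN ger0_norm.
  rewrite (le_trans (GM _ _))//; set d := _ / _ in d0 *.
  by rewrite (_ : _ - _ = d) ?ger0_norm//; ring.
rewrite (eq_big_nat _ _ (F2 := fun i => (2 * pi / N%:R) ^+ 2 *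
  (\sum_(0 <= l < N) v l * kap (2 * pi / N%:R * (i%:R - l%:R - 2^-1))) ^+ 2)).
  rewrite -mulr_sumr.
  apply: (@le_trans _ _ ((2 * pi / N%:R) ^+ 2 *
            (N%:R ^+ 2 * \sum_(0 <= l < N) (M * (2 * pi / N%:R)) ^+ 2))).
    rewrite ler_wpM2l ?sqr_ge0// (le_trans (discrete_hilbert v N0))//.
    by rewrite ler_wpM2l ?sqr_ge0// ler_sum.
  rewrite big_const_nat subn0 iter_addr addr0 -mulr_natr le_eqVlt; apply/orP; left.
  by apply/eqP; field; rewrite gt_eqF.
move=> i _; rewrite (_ : c + _ * i.+1%:R =
    (c + 2 * pi / N%:R) + 2 * pi / N%:R * i%:R); last by rewrite -(natr1 i); ring.
rewrite !conj_sumE// -mulrBr exprMn -sumrB; congr (_ * _ ^+ 2).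
by apply: eq_big_nat => l _; rewrite -mulrBl.
Qed.

Lemma sqr_sum_le (a : nat -> R) n :
  (\sum_(0 <= k < n) a k) ^+ 2 <= n%:R * \sum_(0 <= k < n) a k ^+ 2.
Proof.
elim: n => [|[|n] IH]; first by rewrite !big_nil expr0n mul0r.
  by rewrite !big_nat1 mul1r.
rewrite big_nat_recr//= [X in _ <= _ * X]big_nat_recr//= -(natr1 n.+1).
set s := \sum_(_ <= _ < _) a _ in IH *; set q := \sum_(_ <= _ < _) _ in IH *.
have q0 : 0 <= q by apply: sumr_ge0 => i _; exact: sqr_ge0.
have n0' : 0 < n.+1%:R :> R by rewrite ltr0n.
(* The weights are chosen so that the induction hypothesis absorbs s^2 / (n + 1). *)
have : 2 * s * a n.+1 <= s ^+ 2 / n.+1%:R + n.+1%:R * a n.+1 ^+ 2.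
  rewrite -subr_ge0 (_ : _ - _ = n.+1%:R * (s / n.+1%:R - a n.+1) ^+ 2).
    by rewrite mulr_ge0// ?sqr_ge0// ltW.
  by field; rewrite gt_eqF.
have : s ^+ 2 / n.+1%:R <= q by rewrite ler_pdivrMr// mulrC.
set u := s ^+ 2 / _; nra.
Qed.

Lemma big_nat_blocks (a : nat -> R) m r :
  \sum_(0 <= i < m * r) a i =
  \sum_(0 <= j < m) \sum_(0 <= k < r) a (j * r + k)%N.
Proof.
elim: m => [|m IH]; first by rewrite mul0n !big_nil.
rewrite big_nat_recr//= -IH (@big_cat_nat _ _ _ (m * r))//=; last by rewrite leq_mul2r leqnSn orbT.
congr (_ + _); rewrite -{1}[(m * r)%N]add0n big_addn mulSn addnK.
by apply: eq_bigr => i _; rewrite addnC.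
Qed.

(** A coarse increment is a sum of r fine ones; the factor r lost in Cauchy-Schwarz cancels against
    N = m r. The bound is therefore free of r, which can tend to infinity with the coarse grid
    fixed. *)
Lemma conj_sum_coarse_diff G m r c M : (0 < m)%N -> (0 < r)%N ->
  periodic G (2 * pi) -> (forall x y, `|G x - G y| <= M * `|x - y|) ->
  \sum_(0 <= j < m) (conj_sum G (m * r) (c + 2 * pi / m%:R * j.+1%:R) -
                     conj_sum G (m * r) (c + 2 * pi / m%:R * j%:R)) ^+ 2 <=
  16 * pi ^+ 4 * M ^+ 2 / m%:R.
Proof.
move=> m0 r0 pG GM; set N := (m * r)%N.
have m0' : 0 < m%:R :> R by rewrite ltr0n.
have r0' : 0 < r%:R :> R by rewrite ltr0n.
have N0 : (0 < N)%N by rewrite muln_gt0 m0.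
pose h i := conj_sum G N (c + 2 * pi / N%:R * i%:R).
apply: (@le_trans _ _ (\sum_(0 <= j < m) r%:R *
    \sum_(0 <= k < r) (h (j * r + k).+1 - h (j * r + k)%N) ^+ 2)).
  apply: ler_sum => j _.
  apply: le_trans (sqr_sum_le (fun k => h (j * r + k).+1 - h (j * r + k)%N) r).
  under [X in _ <= X ^+ 2]eq_bigr do rewrite -addnS.
  rewrite (telescope_sumr (fun k => h (j * r + k)%N))// addn0 -mulSnr /h /N.
  rewrite !natrM le_eqVlt; apply/orP; left; apply/eqP.
  congr ((conj_sum _ _ (_ + _) - conj_sum _ _ (_ + _)) ^+ 2);
    by field; rewrite !gt_eqF.
rewrite -mulr_sumr -(big_nat_blocks (fun i => (h i.+1 - h i) ^+ 2)).
have fine : \sum_(0 <= i < m * r) (h i.+1 - h i) ^+ 2 <=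
  16 * pi ^+ 4 * M ^+ 2 / N%:R := @conj_sum_diff G N c M N0 pG GM.
apply: (le_trans (ler_wpM2l (ltW r0') fine)).
rewrite /N natrM le_eqVlt; apply/orP; left; apply/eqP.
by field; rewrite !gt_eqF.
Qed.

End conjugate_sums.

(** * Differentiability from dyadic increments *)

Section L1_limit.
Context {R : realType}.
Notation mu := (@lebesgue_measure R).

(** The sum [g] of the absolute increments is integrable, hence finite a.e., and |u 0| + g dominates
    the whole sequence. *)
Lemma L1_fast_limit (a b C : R) (u : nat -> R -> R) :
  (forall k, measurable_fun setT (u k)) ->
  (forall k, mu.-integrable `[a, b] (EFin \o u k)) ->
  (forall n, \sum_(0 <= k < n) \int[mu]_(x in `[a, b]) `|u k.+1 x - u k x| <= C) ->
  exists2 h, mu.-integrable `[a, b] (EFin \o h) &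
    forall x, a <= x <= b ->
      \int[mu]_(y in `[a, x]) u k y @[k --> \oo] --> \int[mu]_(y in `[a, x]) h y.
Proof.
move=> mu_ intu uC.
pose d k x : R := `|u k.+1 x - u k x|.
have d0 k x : 0 <= d k x by exact: normr_ge0.
have md k : measurable_fun setT (d k).
  by apply: measurableT_comp => //; exact: measurable_funB.
have intd k : mu.-integrable `[a, b] (EFin \o d k).
  apply: (@integrable_norm _ _ _ mu `[a, b]%classic (u k.+1 \- u k)).
  have := integrableB _ (intu k.+1) (intu k).
  by apply.
pose g x : \bar R := (\sum_(k <oo) (d k x)%:E)%E.
have g0 x : (0 <= g x)%E by apply: nneseries_ge0 => n _ _; rewrite lee_fin.
have mg : measurable_fun `[a, b] g.
  apply: ge0_emeasurable_sum => //.
    by move=> k x _ _; rewrite lee_fin.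
  by move=> k _; apply/measurable_EFinP; exact: measurable_funS (md k).
have intg : mu.-integrable `[a, b] g.
  apply/integrableP; split => //.
  under eq_integral do rewrite gee0_abs//.
  rewrite integral_nneseries//; first last.
    by move=> k x _; rewrite lee_fin.
    by move=> k; apply/measurable_EFinP; exact: measurable_funS (md k).
  apply: (@le_lt_trans _ _ C%:E); last exact: ltry.
  apply: lime_le.
    by apply: is_cvg_nneseries => n _ _; apply: integral_ge0 => x _; rewrite lee_fin.
  apply: nearW => n; apply: (@le_trans _ _
    (\sum_(0 <= k < n) \int[mu]_(x in `[a, b]) d k x)%:E).
    rewrite -sumEFin; apply: lee_sum => k _.
    by rewrite /Rintegral fineK//; exact: (@integrable_fin_num _ _ _ mu _ _ _ (intd k)).
  by rewrite lee_fin; exact: uC.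
have ucvg x : (g x < +oo)%E -> cvgn (u ^~ x).
  move=> gx.
  have : cvgn (series (fun k => d k x)).
    apply: nondecreasing_is_cvgn.
      by apply/nondecreasing_seqP => n; rewrite /series/= big_nat_recr//= lerDl.
    exists (fine (g x)) => _ [n _ <-].
    rewrite -lee_fin fineK ?ge0_fin_numE// /series/= -sumEFin.
    by apply: nneseries_lim_ge => k _ _; rewrite lee_fin.
  move=> /normed_cvg.
  have -> : series (fun k => u k.+1 x - u k x) = (fun n => u n x - u 0%N x).
    by apply/funext => n; rewrite /series/= telescope_sumr.
  move=> /cvg_ex[l ul]; apply/cvg_ex; exists (l + u 0%N x).
  rewrite (_ : u ^~ x = (fun n => (u n x - u 0%N x) + u 0%N x)).
    by apply: cvgD => //; exact: cvg_cst.
  by apply/funext => n; rewrite subrK.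
(* The upper limit exists everywhere and is measurable; it is the limit wherever [g] is finite. *)
pose he x := limn_esup (fun k => (u k x)%:E).
have mhe : measurable_fun setT he.
  by apply: measurable_fun_limn_esup => k; exact/measurable_EFinP.
pose h x := fine (he x).
have mh : measurable_fun setT h.
  by apply: measurableT_comp mhe => //; exact: fine_measurable.
have hE x : (g x < +oo)%E -> u k x @[k --> \oo] --> h x.
  move=> /ucvg /cvg_ex[l ul]; rewrite /h /he.
  have /cvg_limn_einf_sup[_ ->] // : (u k x)%:E @[k --> \oo] --> l%:E.
  by apply: cvg_EFin => //; exact: nearW.
have gfin : {ae mu, forall x, `[a, b]%classic x -> u k x @[k --> \oo] --> h x}.
  have := integrable_ae _ intg; move=> /(_ (measurable_itv _)).
  apply: filterS => x /[apply]; rewrite ge0_fin_numE//; exact: hE.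
have udom n x : (`|(u n x)%:E| <= `|(u 0%N x)%:E| + g x)%E.
  apply: (@le_trans _ _ (`|(u 0%N x)%:E| + \sum_(0 <= k < n) (d k x)%:E)%E).
    rewrite sumEFin/= -EFinD lee_fin.
    elim: n => [|n IH]; first by rewrite big_nil addr0.
    rewrite big_nat_recr//= addrA.
    rewrite -[u n.+1 x](subrK (u n x)) (le_trans (ler_normD _ _))// addrC.
    by rewrite lerD.
  by rewrite leeD2l//; apply: nneseries_lim_ge => k _ _; rewrite lee_fin.
have intdom : mu.-integrable `[a, b] (fun x => `|(u 0%N x)%:E| + g x)%E.
  apply: integrableD => //.
  exact: integrable_abse (intu 0%N).
have dom x : a <= x <= b -> mu.-integrable `[a, x] (EFin \o h) /\
   (\int[mu]_(y in `[a, x]) (u k y)%:E @[k --> \oo] -->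
     \int[mu]_(y in `[a, x]) (h y)%:E)%E.
  move=> /andP[ax xb].
  have sub : `[a, x] `<=` `[a, b]%classic by apply: subset_itvl; rewrite bnd_simp.
  have [] := @dominated_convergence _ _ _ mu `[a, x]%classic _
    (fun n y => (u n y)%:E) (fun y => (h y)%:E) (fun y => `|(u 0%N y)%:E| + g y)%E.
  - by [].
  - by move=> n; apply/measurable_EFinP; exact: measurable_funS (mu_ n).
  - by apply/measurable_EFinP; exact: measurable_funS mh.
  - apply: (lebesgue_aeS gfin) => y + /sub => /[apply] uh.
    by apply: cvg_EFin => //; exact: nearW.
  - exact: integrableS intdom.
  - by apply: aeW => y n _; exact: udom.
  - by move=> ? _ ?.
exists h.
  have [ab|ba] := leP a b; first by apply: (dom b _).1; rewrite ab lexx.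
  by rewrite set_itv_ge ?bnd_simp -?ltNge//; exact: integrable_set0.
move=> x /dom[inth cvgh]; apply: fine_cvg; rewrite fineK//.
exact: integrable_fin_num.
Qed.

End L1_limit.

Section cells.
Context {R : realType}.
Notation mu := (@lebesgue_measure R).

Lemma Rintegral_cell (u v c : R) (g : R -> R) : u <= v ->
  mu.-integrable `[u, v] (EFin \o g) ->
  (forall x, u <= x < v -> g x = c) ->
  \int[mu]_(x in `[u, v]) g x = c * (v - u).
Proof.
move=> uv intg gc; rewrite -Rintegral_itv_bndo_bndc; last first.
  by apply: integrableS intg => //; apply: subset_itvl; rewrite bnd_simp.
rewrite (@eq_Rintegral _ _ _ _ _ (cst c)); last first.
  by move=> x /set_mem/=; rewrite in_itv/=; exact: gc.
rewrite Rintegral_itv_bndo_bndc ?Rintegral_itv_cst//.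
apply: (integrableS _ _ _ (integrable_itv_cst u v c)) => //.
by apply: subset_itvl; rewrite bnd_simp.
Qed.

Lemma Rintegral_cells (y c : nat -> R) (g : R -> R) p :
  (forall j, (j < p)%N -> y j <= y j.+1) ->
  mu.-integrable `[y 0%N, y p] (EFin \o g) ->
  (forall j x, (j < p)%N -> y j <= x < y j.+1 -> g x = c j) ->
  \int[mu]_(x in `[y 0%N, y p]) g x = \sum_(0 <= j < p) c j * (y j.+1 - y j).
Proof.
elim: p => [|p IH] yy intg gc; first by rewrite big_nil set_itv1 Rintegral_set1.
have y0p : y 0%N <= y p.
  elim: p yy {IH intg gc} => // p IH yy.
  by apply: (le_trans (IH _)) => [j jp|]; apply: yy => //; exact: leqW.
rewrite big_nat_recr//= (@Rintegral_itv_split _ _ _ _ (y p))//; last by rewrite y0p yy.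
congr (_ + _).
  apply: IH => [j jp||j x jp]; [exact/yy/leqW| |exact/gc/leqW].
  by apply: integrable_itvS intg => //; exact: yy.
apply: Rintegral_cell; [exact: yy| |by move=> x; exact: gc].
exact: integrable_itvS intg.
Qed.

End cells.

(** * The martingale of dyadic difference quotients *)

Section dyadic_quotients.
Context {R : realType}.
Notation mu := (@lebesgue_measure R).
Variables (f : R -> R) (a l : R).
Hypothesis l0 : 0 < l.

Let node n j : R := a + l * (j%:R / 2 ^+ n).
Let slope n j : R := (f (node n j.+1) - f (node n j)) * (2 ^+ n / l).
Let quot n x : R :=
  \sum_(0 <= j < 2 ^ n) slope n j * \1_(`[node n j, node n j.+1[) x.

Let pow2_gt0 n : 0 < 2 ^+ n :> R. Proof. by rewrite exprn_gt0. Qed.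

Let node_le n i j : (i <= j)%N -> node n i <= node n j.
Proof.
by move=> ij; rewrite lerD2l ler_pM2l// ler_pM2r ?invr_gt0// ler_nat.
Qed.

Let node0 n : node n 0%N = a. Proof. by rewrite /node mul0r mulr0 addr0. Qed.

Let node_max n : node n (2 ^ n) = a + l.
Proof. by rewrite /node natrX divff ?mulr1// gt_eqF. Qed.

Let nodeD n p j : node n j = node (n + p) (j * 2 ^ p).
Proof.
rewrite /node natrM natrX exprD; congr (_ + _ * _).
by rewrite invfM mulrACA divff ?mulr1// gt_eqF.
Qed.

Let node_succ n j : node n j.+1 - node n j = l / 2 ^+ n.
Proof. by rewrite /node -natr1; field; rewrite gt_eqF. Qed.

Let quotE n j x : (j < 2 ^ n)%N -> node n j <= x < node n j.+1 ->
  quot n x = slope n j.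
Proof.
move=> jn /andP[jx xj]; rewrite /quot big_mkord (bigD1 (Ordinal jn))//=.
rewrite indicE mem_set ?mulr1/=; last by rewrite in_itv/= jx xj.
rewrite big1 ?addr0// => -[i iN] /=; rewrite -val_eqE/= => ij.
rewrite indicE memNset ?mulr0//= in_itv/= => /andP[ix xi].
move: ij; rewrite neq_ltn => /orP[] ij.
  by move: (lt_le_trans xi (node_le n ij)); rewrite ltNge jx.
by move: (lt_le_trans xj (node_le n ij)); rewrite ltNge ix.
Qed.

Let measurable_quot n : measurable_fun setT (quot n).
Proof.
apply: measurable_sum => j; apply: measurable_funM => //.
Qed.

Let quot_le n x : `|quot n x| <= \sum_(0 <= j < 2 ^ n) `|slope n j|.
Proof.
rewrite (le_trans (ler_norm_sum _ _ _))// ler_sum// => j _.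
by rewrite normrM indicE ler_piMr//; case: (_ \in _); rewrite ?normr1 ?normr0.
Qed.

Let integrable_quot n u v : mu.-integrable `[u, v] (EFin \o quot n).
Proof.
apply: (@bounded_integrable_itv _ _ _ _ (\sum_(0 <= j < 2 ^ n) `|slope n j|)).
  exact: measurable_funS (measurable_quot n).
by move=> x _; exact: quot_le.
Qed.

Let slopeD n p j : slope n j * 2 ^+ p =
  \sum_(0 <= k < 2 ^ p) slope (n + p) (j * 2 ^ p + k).
Proof.
rewrite /slope -mulr_suml.
under eq_bigr do rewrite -addnS.
rewrite (telescope_sumr (fun k => f (node (n + p) (j * 2 ^ p + k))))//.
rewrite addn0 -mulSnr -!nodeD exprD.
by ring.
Qed.

(** The slopes telescope. The value is the same for all p, so it survives in the limit of the step
    functions. *)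
Let Rintegral_quot n p j : (j <= 2 ^ n)%N ->
  \int[mu]_(x in `[a, node n j]) quot (n + p) x = f (node n j) - f a.
Proof.
move=> jn; rewrite -{1}(node0 (n + p)) (nodeD n p j).
rewrite (@Rintegral_cells _ (node (n + p)) (slope (n + p)))//; last first.
  move=> i x ij; apply: quotE; apply: (leq_trans ij).
  by rewrite expnD leq_mul2r jn orbT.
  by move=> i _; exact: node_le.
under eq_bigr do rewrite node_succ /slope -mulrA mulf_div mulrC
  [X in X / _]mulrC divff ?mul1r ?mulf_neq0 ?gt_eqF//.
by rewrite (telescope_sumr (fun k => f (node (n + p) k)))// node0.
Qed.

Let energy n : R := \sum_(0 <= j < 2 ^ n) slope n j ^+ 2 * (l / 2 ^+ n).

(** Martingale orthogonality: by [slopeD] a coarse slope is the mean of the fine slopes in its cell,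
    so the cross term is - 2 times the coarse energy. *)
Let Rintegral_quotB n p :
  \int[mu]_(x in `[a, a + l]) (quot (n + p) x - quot n x) ^+ 2 =
  energy (n + p) - energy n.
Proof.
rewrite -{1}(node0 (n + p)) -(node_max (n + p)).
rewrite (@Rintegral_cells _ (node (n + p))
   (fun i => (slope (n + p) i - slope n (i %/ 2 ^ p)) ^+ 2))//; last 3 first.
- by move=> j _; exact: node_le.
- apply: (@bounded_integrable_itv _ _ _ _
    ((\sum_(0 <= j < 2 ^ (n + p)) `|slope (n + p) j| +
      \sum_(0 <= j < 2 ^ n) `|slope n j|) ^+ 2)).
    apply: measurable_funX.
    by apply: measurable_funS (measurable_funB (measurable_quot _) (measurable_quot _)).
  move=> x _; rewrite normrX lerXn2r ?nnegrE//.
    by rewrite addr_ge0// sumr_ge0.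
  by rewrite (le_trans (ler_normB _ _))// lerD.
- move=> i x ilt ix; rewrite (quotE ilt ix) (@quotE _ (i %/ 2 ^ p))//.
    by rewrite ltn_divLR ?expn_gt0// -expnD.
  move: ix => /andP[ix xi]; rewrite (nodeD n p) (nodeD n p).
  apply/andP; split; first by apply: le_trans ix; apply: node_le; exact: leq_trunc_div.
  by apply: (lt_le_trans xi); apply: node_le; rewrite ltn_ceil// expn_gt0.
under eq_bigr do rewrite node_succ.
rewrite expnD big_nat_blocks /energy expnD big_nat_blocks -sumrB.
apply: eq_bigr => j _.
have r0 : 0 < 2 ^+ p :> R by [].
under eq_big_nat => k /andP[_ kp].
  rewrite divnMDl ?expn_gt0// divn_small// addn0.
  rewrite (_ : _ * _ = slope (n + p) (j * 2 ^ p + k) ^+ 2 * (l / 2 ^+ (n + p)) +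
     ((slope n j ^+ 2 * (l / 2 ^+ (n + p))) -
      slope (n + p) (j * 2 ^ p + k) * (2 * slope n j * (l / 2 ^+ (n + p))))); last by ring.
  over.
rewrite big_split/=; congr (_ + _); rewrite big_split/= sumr_const_nat subn0.
rewrite sumrN -mulr_suml -slopeD -[_ *+ _]mulr_natr natrX exprD.
by field; rewrite !gt_eqF.
Qed.

Let energy_nd n p : energy n <= energy (n + p).
Proof.
rewrite -subr_ge0 -Rintegral_quotB; apply: Rintegral_ge0 => x _; exact: sqr_ge0.
Qed.

(** From L^2 to L^1 by |t| <= c t^2 + 1 / c. The free c will be 2^k, against an energy gap of at
    most 4^-k. *)
Let Rintegral_normr_quotB n p (c : R) : 0 < c ->
  \int[mu]_(x in `[a, a + l]) `|quot (n + p) x - quot n x| <=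
  c * (energy (n + p) - energy n) + c^-1 * l.
Proof.
move=> c0; have al : a <= a + l by rewrite lerDl ltW.
have mB : measurable_fun `[a, a + l] (fun x => quot (n + p) x - quot n x).
  exact: measurable_funS (measurable_funB (measurable_quot _) (measurable_quot _)).
have bB x : `|quot (n + p) x - quot n x| <=
    \sum_(0 <= j < 2 ^ (n + p)) `|slope (n + p) j| + \sum_(0 <= j < 2 ^ n) `|slope n j|.
  by rewrite (le_trans (ler_normB _ _))// lerD.
have i2 : mu.-integrable `[a, a + l]
    (EFin \o (fun x => (quot (n + p) x - quot n x) ^+ 2)).
  apply: (@bounded_integrable_itv _ _ _ _
    ((\sum_(0 <= j < 2 ^ (n + p)) `|slope (n + p) j| +
      \sum_(0 <= j < 2 ^ n) `|slope n j|) ^+ 2)).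
    exact: measurable_funX.
  move=> x _; rewrite normrX lerXn2r ?nnegrE//.
  by rewrite (le_trans _ (bB x)).
have i2c : mu.-integrable `[a, a + l]
    (EFin \o (fun x => c * (quot (n + p) x - quot n x) ^+ 2)).
  exact: integrable_mulrl.
rewrite -Rintegral_quotB -RintegralZl//.
have <- : \int[mu]_(x in `[a, a + l]) c^-1 = c^-1 * l.
  by rewrite Rintegral_itv_cst// addrC addKr.
rewrite -RintegralD//; last exact: integrable_itv_cst.
apply: le_Rintegral => //.
- apply: bounded_integrable_itv => [|x _]; first exact: measurableT_comp mB.
  by rewrite normr_id; exact: bB.
- exact: integrable_addr i2c (integrable_itv_cst a (a + l) c^-1).
- move=> x _; set t := quot _ _ - _.
  rewrite -(real_normK (num_real t)); set s := `|t|.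
  (* The difference of the two sides, with its square completed. *)
  have -> : c * s ^+ 2 + c^-1 = s + c * ((s - (2 * c)^-1) ^+ 2 + 3 * (2 * c)^-1 ^+ 2).
    by field; rewrite gt_eqF.
  by rewrite lerDl mulr_ge0 ?(ltW c0)// addr_ge0 ?sqr_ge0// mulr_ge0// sqr_ge0.
Qed.

Variable K : R.
Hypothesis energyK : forall n, energy n <= K.

Let dyadic_density : exists2 h, mu.-integrable `[a, a + l] (EFin \o h) &
  forall n j, (j <= 2 ^ n)%N ->
    f (node n j) = f a + \int[mu]_(x in `[a, node n j]) h x.
Proof.
have cvgE : cvgn energy.
  apply: nondecreasing_is_cvgn.
    by apply/nondecreasing_seqP => n; rewrite -addn1; exact: energy_nd.
  by exists K => _ [n _ <-].
have ex k : exists N, forall n p, (N <= n)%N -> energy (n + p) - energy n <= (4 ^+ k)^-1.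
  have /cvgrPdist_lt /(_ (4 ^+ k)^-1) := cvgE.
  rewrite invr_gt0 exprn_gt0// => /(_ isT)[N _ NE]; exists N => n p Nn.
  have := NE n Nn; rewrite ltr_norml => /andP[_ /ltW]; apply: le_trans.
  rewrite lerD2r; apply: nondecreasing_cvgn_le => //.
  by apply/nondecreasing_seqP => i; rewrite -addn1; exact: energy_nd.
have [N NE] := choice ex.
(* A strictly increasing choice of ranks with s k >= N k; the successors make it increase even where
   [N] vanishes. *)
pose s k := (\sum_(i < k.+1) (N i).+1)%N.
have sS k : s k.+1 = (s k + (N k.+1).+1)%N by rewrite /s big_ord_recr.
have sN k : (N k <= s k)%N by rewrite /s big_ord_recr/= addnS leqW// leq_addl.
have sk k : (k <= s k)%N.
  by elim: k => // k IH; rewrite sS addnS ltnS (leq_trans IH)// leq_addr.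
(* With c = 2^k the k-th term is at most 2^k 4^-k + 2^-k l = (1 + l) 2^-k. *)
have small n : \sum_(0 <= k < n)
    \int[mu]_(x in `[a, a + l]) `|quot (s k.+1) x - quot (s k) x| <= 2 * (1 + l).
  apply: (@le_trans _ _ (\sum_(0 <= k < n) (1 + l) * (2 ^+ k)^-1)).
    apply: ler_sum => k _; rewrite sS.
    apply: (le_trans (Rintegral_normr_quotB (s k) (N k.+1).+1 (pow2_gt0 k))).
    rewrite mulrDl mul1r [l * _]mulrC lerD2r.
    apply: (le_trans (ler_wpM2l (ltW (pow2_gt0 k)) (NE k (s k) _ (sN k)))).
    rewrite (_ : 4 = 2 * 2); last by rewrite -natrM.
    by rewrite exprMn invfM mulrA divff ?mul1r// gt_eqF.
  rewrite -mulr_sumr [2 * _]mulrC ler_wpM2l ?addr_ge0// ?(ltW l0)//.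
  suff -> : \sum_(0 <= i < n) (2 ^+ i)^-1 = 2 - 2 * (2 ^+ n)^-1 :> R.
    by rewrite lerBlDr lerDl mulr_ge0// invr_ge0 ltW.
  elim: n => [|n IH]; first by rewrite big_nil expr0; lra.
  by rewrite big_nat_recr//= IH exprS; field; rewrite gt_eqF.
have [h inth hE] := @L1_fast_limit R a (a + l) _ (fun k => quot (s k))
  (fun k => measurable_quot (s k)) (fun k => integrable_quot (s k) a (a + l)) small.
exists h => // n j jn; apply/eqP; rewrite addrC -subr_eq; apply/eqP.
have := hE (node n j); rewrite -{1}(node0 n) -(node_max n) !node_le// => /(_ isT).
apply: (@cvg_unique _ _ _ _ _ _ _) => //.
(* Once s k >= n, the node has rank at most s k, and the integral up to it no longer changes. *)
apply: (@cvg_near_cst) => //; near=> k.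
rewrite -[s k](@subnKC n); last first.
  by apply: leq_trans (sk k); near: k; exact: nbhs_infty_ge.
exact: Rintegral_quot.
Unshelve. all: by end_near. Qed.

Hypothesis cf : continuous f.

(** Both sides are continuous in x and agree at the dyadic nodes; [t n] is the index of the last
    node of rank n up to x. *)
Let density : exists2 h, mu.-integrable `[a, a + l] (EFin \o h) &
  forall x, a < x < a + l -> f x = f a + \int[mu]_(y in `[a, x]) h y.
Proof.
have [h inth hE] := dyadic_density.
exists h => // x /andP[ax xl].
have al : a < a + l by rewrite ltrDl.
have := parameterized_integral_continuous (ltW al) inth.
move=> /(continuous_within_itvP _ al)[+ _ _].
rewrite /parameterized_integral => /(_ x); rewrite in_itv/= ax xl => /(_ isT) ch.
pose t n := Num.truncn (2 ^+ n * ((x - a) / l)).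
have xal0 : 0 <= (x - a) / l by rewrite divr_ge0 ?subr_ge0// ltW.
have tP n : (t n)%:R <= 2 ^+ n * ((x - a) / l) < (t n).+1%:R.
  by apply: truncn_itv; rewrite mulr_ge0// ltW.
have cz : node n (t n) @[n --> \oo] --> x.
  have h2 : x - l / 2 ^+ n @[n --> \oo] --> x - l * 0.
    apply: cvgB; first exact: cvg_cst.
    apply: cvgM; first exact: cvg_cst.
    under [X in X @ _]eq_fun do rewrite -exprVn.
    by apply: cvg_expr; rewrite ger0_norm ?invr_ge0// invf_lt1 ?ltr1n.
  rewrite mulr0 subr0 in h2; apply: (squeeze_cvgr _ h2 (cvg_cst x)).
  near=> n; have /andP[tl tu] := tP n.
  have xE : x = a + l * (2 ^+ n * ((x - a) / l) / 2 ^+ n).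
    by field; rewrite !gt_eqF.
  apply/andP; split.
    rewrite lerBlDr [X in X <= _]xE /node -addrA lerD2l -mulrDr ler_pM2l//.
    by rewrite -[X in _ <= _ + X]mul1r -mulrDl ler_pM2r ?invr_gt0// natr1 ltW.
  by rewrite [X in _ <= X]xE /node lerD2l ler_pM2l// ler_pM2r ?invr_gt0.
have t2 n : (t n <= 2 ^ n)%N.
  have /andP[tl _] := tP n; rewrite -(ler_nat R) natrX (le_trans tl)//.
  by rewrite ler_piMr// ler_pdivrMr// mul1r; lra.
have c1 : f (node n (t n)) @[n --> \oo] --> f x.
  by apply: continuous_cvg => //; exact: cf.
have c2 : f a + \int[mu]_(y in `[a, node n (t n)]) h y @[n --> \oo] -->
    f a + \int[mu]_(y in `[a, x]) h y.
  apply: cvgD; first exact: cvg_cst.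
  pose F (z : R) : R := \int[mu]_(y in `[a, z]) h y.
  suff : F (node n (t n)) @[n --> \oo] --> F x by [].
  by apply: continuous_cvg => //; exact: ch.
have e12 : (fun n => f (node n (t n))) = (fun n => f a + \int[mu]_(y in `[a, node n (t n)]) h y).
  by apply/funext => n; rewrite hE.
by rewrite e12 in c1; exact: (cvg_unique _ c1 c2).
Unshelve. all: by end_near. Qed.

(* Bounded energies make the dyadic difference quotients a Cauchy sequence in
   L^2, so f is the indefinite integral of an integrable density. *)
Lemma derivable_ae_of_energy : {ae mu, forall x, a < x < a + l -> derivable f x 1}.
Proof.
have [h inth hE] := density.
(* Extension by 0, since the differentiation theorem asks for local integrability on the whole
   line. *)
pose hh := h \_ `[a, a + l].
have inthh u v : mu.-integrable `[u, v] (EFin \o hh).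
  apply: (@integrableS _ _ _ mu setT) => //.
  by rewrite /hh -restrict_EFin; exact/(integrable_mkcond _ _).1.
have loc : locally_integrable setT hh by exact: integrable_locally_restrict.
have := @FTC1 R hh (BLeft a) (fun y => inthh a y) loc.
move=> /lebesgue_aeS; apply => x + /andP[ax xl].
rewrite /= lte_fin => /(_ ax)[dF _].
have dF' : derivable (fun y => f a + \int[mu]_(t in `[a, y]) hh t) x 1.
  exact: (derivableD (derivable_cst (f a) x 1) dF).
apply: (near_eq_derivable _ dF') => //.
near=> y.
have ay : a < y by near: y; exact: lt_nbhsr.
have yl : y < a + l by near: y; exact: lt_nbhsl.
rewrite (hE y) ?ay ?yl//; congr (_ + _); apply: eq_Rintegral => z.
rewrite inE/= in_itv/= => /andP[az zy].
by rewrite /hh patchE mem_set//= in_itv/= az (le_trans zy)// ltW.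
Unshelve. all: by end_near. Qed.

End dyadic_quotients.

Lemma derivable_ae_dyadic {R : realType} (f : R -> R) (a l K : R) : 0 < l ->
  continuous f ->
  (forall n, 2 ^+ n * \sum_(0 <= j < 2 ^ n)
    (f (a + l * (j.+1%:R / 2 ^+ n)) - f (a + l * (j%:R / 2 ^+ n))) ^+ 2 <= K) ->
  {ae @lebesgue_measure R, forall x, a < x < a + l -> derivable f x 1}.
Proof.
move=> l0 cf fK; apply: (@derivable_ae_of_energy R f a l l0 (K / l) _ cf) => n.
apply: le_trans (ler_wpM2r _ (fK n)); last by rewrite invr_ge0 ltW.
rewrite mulr_sumr mulr_suml le_eqVlt; apply/orP; left; apply/eqP.
by apply: eq_bigr => j _; field; rewrite !gt_eqF.
Qed.

Lemma derivable_ae_line {R : realType} (f : R -> R) (l K : R) : 0 < l ->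
  continuous f ->
  (forall a n, 2 ^+ n * \sum_(0 <= j < 2 ^ n)
    (f (a + l * (j.+1%:R / 2 ^+ n)) - f (a + l * (j%:R / 2 ^+ n))) ^+ 2 <= K) ->
  {ae @lebesgue_measure R, forall x, derivable f x 1}.
Proof.
move=> l0 cf fK.
(* Intervals of length l starting at the multiples of l / 2 overlap, so that every point is interior
   to one of them: x lies in the right half of the one for z = floor (2 x / l), or at its
   midpoint. *)
pose c (z : int) : R := l / 2 * (z - 1)%:~R.
have Hn n : {ae @lebesgue_measure R, forall x, forall z : int, unpickle n = Some z ->
    c z < x < c z + l -> derivable f x 1}.
  case: (unpickle n) => [z|]; last by apply: aeW.
  apply: (lebesgue_aeS (derivable_ae_dyadic l0 cf (fK (c z)))) => x h _ [<-]; exact: h.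
have H : {ae @lebesgue_measure R, forall x, forall n, forall z : int, unpickle n = Some z ->
    c z < x < c z + l -> derivable f x 1} by exact: ae_foralln.
apply: (lebesgue_aeS H) => x /(_ (pickle (Num.floor (x / (l / 2)))) _ (pickleK _)); apply.
have /andP[] := floor_itv (x / (l / 2)); set z := Num.floor _ => z1 z2.
have l20 : 0 < l / 2 by rewrite divr_gt0.
rewrite ler_pdivlMr// in z1; rewrite ltr_pdivrMr// in z2.
rewrite intrD mulrDl mulr1z mul1r in z2.
rewrite /c intrB mulr1z mulrBr mulr1 [l / 2 * _]mulrC; apply/andP; split; lra.
Qed.

(** * Riemann-Stieltjes integration by parts *)

Section riemann_stieltjes.
Context {R : realType}.
Notation mu := (@lebesgue_measure R).

(** The sums evaluate [Phi], the integral evaluates [phi]. Only x is confined to the good set [A];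
    the tag y is any nearby point, because a partition cannot be made to choose its tags in [A]. *)
Definition ae_modulus (Phi phi : R -> R) (a b : R) : Prop :=
  forall eta : R, 0 < eta -> exists A : set R, exists delta : R,
    [/\ measurable A, 0 < delta, (mu (`[a, b] `&` ~` A) <= eta%:E)%E &
        forall x y, A x -> a <= x <= b -> a <= y <= b -> `|y - x| < delta ->
          `|Phi y - phi x| <= eta].

Variables (Phi phi k w : R -> R) (a b C W : R).
Hypotheses (ab : a <= b) (C0 : 0 <= C) (W0 : 0 <= W).
Hypotheses (PhiC : forall x, `|Phi x| <= C) (phiC : forall x, `|phi x| <= C).
Hypotheses (mphi : measurable_fun setT phi) (mw : measurable_fun setT w).
Hypothesis wW : forall x, a <= x <= b -> `|w x| <= W.
Hypothesis kw : forall u v, a <= u -> u <= v -> v <= b ->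
  k v - k u = \int[mu]_(x in `[u, v]) w x.
Hypothesis mod : ae_modulus Phi phi a b.

Let intphiw u v : a <= u -> v <= b -> mu.-integrable `[u, v] (EFin \o (fun x => phi x * w x)).
Proof.
move=> au vb; apply: (@bounded_integrable_itv _ _ _ _ (C * W)).
  by apply: measurable_funS (measurable_funM mphi mw).
move=> x /andP[ux xv]; rewrite normrM ler_pM// wW//.
by rewrite (le_trans au)// (le_trans xv).
Qed.

Let intw u v : a <= u -> v <= b -> mu.-integrable `[u, v] (EFin \o w).
Proof.
move=> au vb; apply: (@bounded_integrable_itv _ _ _ _ W).
  exact: measurable_funS mw.
by move=> x /andP[ux xv]; rewrite wW// (le_trans au)// (le_trans xv).
Qed.

(** Majorant of |Phi t - phi x| |w x| for a tag t near x: eta comes from the modulus, and the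
    trivial bound 2 C is added off [A]. *)
Let maj (A : set R) eta (x : R) : R := W * (eta + 2 * C * \1_(~` A) x).

Let measurable_maj A eta : measurable A -> measurable_fun setT (maj A eta).
Proof.
move=> mA; apply: measurable_funM => //; apply: measurable_funD => //.
by apply: measurable_funM => //; apply: measurable_indic; exact: measurableC.
Qed.

Let intmaj A eta u v : measurable A -> mu.-integrable `[u, v] (EFin \o maj A eta).
Proof.
move=> mA; apply: (@bounded_integrable_itv _ _ _ _ (W * (`|eta| + 2 * C))).
  exact: measurable_funS (measurable_maj eta mA).
move=> x _; rewrite /maj normrM (ger0_norm W0) ler_wpM2l//.
rewrite (le_trans (ler_normD _ _))// lerD2l normrM indicE ger0_norm ?mulr_ge0//.
by rewrite ler_piMr ?mulr_ge0//; case: (_ \in _); rewrite ?normr0 ?normr1.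
Qed.

Let Rintegral_maj A (eta : R) : measurable A -> 0 <= eta ->
  (mu (`[a, b] `&` ~` A) <= eta%:E)%E ->
  \int[mu]_(x in `[a, b]) maj A eta x <= W * (eta * (b - a) + 2 * C * eta).
Proof.
move=> mA eta0 muA.
have ind : mu.-integrable `[a, b] (EFin \o (\1_(~` A) : R -> R)).
  apply: (@bounded_integrable_itv _ _ _ _ 1).
    by apply: measurable_funTS; apply: measurable_indic; exact: measurableC.
  by move=> x _; rewrite indicE; case: (_ \in _); rewrite ?normr0 ?normr1.
have ind2 := integrable_mulrl (2 * C) (measurable_itv _) ind.
have inte := integrable_itv_cst a b eta.
rewrite RintegralZl//; last exact: integrable_addr.
rewrite ler_wpM2l// RintegralD// Rintegral_itv_cst// lerD2l RintegralZl//.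
rewrite ler_wpM2l ?mulr_ge0//.
rewrite /Rintegral integral_indic//; last exact: measurableC.
rewrite -lee_fin fineK; first by rewrite setIC.
by rewrite ge0_fin_numE// setIC (le_lt_trans muA)// ltry.
Qed.

Let cell_le A eta delta u v t : measurable A -> 0 <= eta -> a <= u -> u <= v -> v <= b ->
  (forall x y, A x -> a <= x <= b -> a <= y <= b -> `|y - x| < delta ->
     `|Phi y - phi x| <= eta) ->
  a <= t <= b -> (forall x, u <= x <= v -> `|t - x| < delta) ->
  `|Phi t * (k v - k u) - \int[mu]_(x in `[u, v]) (phi x * w x)| <=
  \int[mu]_(x in `[u, v]) maj A eta x.
Proof.
move=> mA eta0 au uv vb modA tab tx.
have iw := intw au vb; have ipw := intphiw au vb.
rewrite kw// -RintegralZl// -RintegralB//; last exact: integrable_mulrl.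
have idiff := integrable_subr (measurable_itv _) (integrable_mulrl (Phi t) (measurable_itv _) iw) ipw.
rewrite (le_trans (le_normr_Rintegral _ _))//.
apply: le_Rintegral => //.
- exact: (integrable_norm idiff).
- exact: intmaj.
- move=> x /=; rewrite in_itv/= => /andP[ux xv].
  have xab : a <= x <= b by rewrite (le_trans au ux) (le_trans xv vb).
  rewrite -mulrBl normrM mulrC /maj ler_pM// ?wW//.
  rewrite indicE; have [xA|xA] := boolP (x \in ~` A).
    rewrite mulr1 (le_trans (ler_normB _ _))// (le_trans (lerD (PhiC _) (phiC _)))//.
    lra.
  rewrite mulr0 addr0; apply: modA => //.
    by apply: contrapT => nA; move: xA => /negP; apply; rewrite inE.
  by apply: tx; rewrite ux.
Qed.

(** As [k] is a primitive of [w], the error on a cell is the integral of (Phi t - phi x) w x, and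
    the total error is at most the integral of [maj]. *)
Lemma weighted_sum_cvg (e : R) : 0 < e -> exists2 d, 0 < d &
  forall p (s t : nat -> R), s 0%N = a -> s p = b ->
    (forall j, (j < p)%N -> s j <= s j.+1) ->
    (forall j, (j < p)%N -> a <= t j <= b) ->
    (forall j x, (j < p)%N -> s j <= x <= s j.+1 -> `|t j - x| < d) ->
    `|\sum_(0 <= j < p) Phi (t j) * (k (s j.+1) - k (s j)) -
      \int[mu]_(x in `[a, b]) (phi x * w x)| < e.
Proof.
(* [Rintegral_maj] bounds the error by K eta; the choice eta = e / (K + 1) also covers K = 0. *)
move=> e0; pose K := W * ((b - a) + 2 * C).
have K0 : 0 <= K by rewrite mulr_ge0// addr_ge0 ?subr_ge0// mulr_ge0.
have eta0 : 0 < e / (K + 1) by rewrite divr_gt0// ltr_wpDl.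
have [A [delta [mA delta0 muA modA]]] := mod eta0.
exists delta => // p s t s0 sp ss tab tx.
have step q : (q <= p)%N -> a <= s q /\ s q <= b /\
    `|\sum_(0 <= j < q) Phi (t j) * (k (s j.+1) - k (s j)) -
      \int[mu]_(x in `[a, s q]) (phi x * w x)| <=
    \int[mu]_(x in `[a, s q]) maj A (e / (K + 1)) x.
  elim: q => [_|q IH qp].
    by rewrite s0 lexx ab big_nil set_itv1 !Rintegral_set1 subrr normr0.
  have [aq [qb IHq]] := IH (ltnW qp); have sq := ss q qp.
  have qb' : s q.+1 <= b.
    rewrite -sp; elim: p qp ss {s0 sp tab tx IH IHq qb sq} => // p IHp.
    rewrite ltnS leq_eqVlt => /predU1P[-> //|qp] ss.
    by apply: le_trans (IHp qp _) (ss _ _) => // j jp; apply: ss; exact: leqW.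
  split; first exact: le_trans sq.
  split => //.
  rewrite big_nat_recr//=.
  rewrite (@Rintegral_itv_split _ _ _ (s q.+1) (s q)) ?aq//; last exact: intphiw.
  rewrite (@Rintegral_itv_split _ (maj _ _) _ (s q.+1) (s q)) ?aq//; last exact: intmaj.
  rewrite opprD addrACA (le_trans (ler_normD _ _))// lerD//.
  apply: cell_le modA _ _ => //; [exact: ltW|exact: tab|by move=> x; exact: tx].
have [_ [_ +]] := step p (leqnn p); rewrite sp => /le_lt_trans; apply.
apply: (le_lt_trans (Rintegral_maj mA (ltW eta0) muA)).
rewrite (_ : W * _ = K * (e / (K + 1))); last by rewrite /K; ring.
by rewrite mulrCA gtr_pMr// ltr_pdivrMr ?mul1r ?ltrDl// ltr_wpDl.
Qed.

Lemma sum_by_parts (u v : nat -> R) p :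
  \sum_(0 <= i < p) v i.+1 * (u i.+1 - u i) =
  u p * v p.+1 - u 0%N * v 0%N - \sum_(0 <= j < p.+1) u j * (v j.+1 - v j).
Proof.
elim: p => [|p IH]; first by rewrite big_nil big_nat1; ring.
by rewrite big_nat_recr//= IH [in RHS]big_nat_recr//=; ring.
Qed.

(** Abel summation exchanges nodes and tags: the sum of [k] against increments of [Phi] becomes a
    sum of [Phi] against increments of [k], to which [weighted_sum_cvg] applies. *)
Lemma is_rs_integral_by_parts :
  is_rs_integral k Phi a b
    (k b * Phi b - k a * Phi a - \int[mu]_(x in `[a, b]) (phi x * w x)).
Proof.
move=> e e0; have [d d0 dP] := weighted_sum_cvg e0.
exists d => // p t s [t0 tp ts] td.
(* The new nodes are a, s_0, ..., s_(p-1), b: there are p + 1 new cells, and t_j is the tag of the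
   cell [v_j, v_(j+1)]. *)
pose v j : R := if j == 0%N then a else if j == p.+1 then b else s j.-1.
have vS j : (j < p)%N -> v j.+1 = s j.
  by move=> jp; rewrite /v/= eqSS ltn_eqF.
have vp : v p.+1 = b by rewrite /v/= eqxx.
have tS j : (j < p)%N -> t j <= t j.+1.
  by move=> /ts[] /le_trans; apply.
have tle i j : (i <= j <= p)%N -> t i <= t j.
  elim: j => [|j IH]; first by rewrite leqn0 => /andP[/eqP ->].
  rewrite leq_eqVlt => /andP[/predU1P[-> //|ij] jp].
  by rewrite (le_trans (IH _))// ?tS// -ltnS ij ltnW.
have tab j : (j <= p)%N -> a <= t j <= b.
  by move=> jp; rewrite -t0 -tp !tle// ?jp ?leqnn.
have vt j : (j <= p)%N -> v j <= t j <= v j.+1.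
  move=> jp; apply/andP; split.
    case: j jp => [|j] jp; first by rewrite t0.
    by rewrite vS//; have [] := ts j jp.
  move: jp; rewrite leq_eqVlt => /predU1P[->|jp]; first by rewrite vp tp.
  by rewrite vS//; have [] := ts j jp.
have -> : rs_sum k Phi p t s = \sum_(0 <= i < p) k (v i.+1) * (Phi (t i.+1) - Phi (t i)).
  by apply: eq_big_nat => i /andP[_ ip]; rewrite vS.
rewrite (sum_by_parts (Phi \o t) (k \o v))/= vp tp t0 -/(v 0%N).
rewrite (_ : v 0%N = a)// [Phi b * _]mulrC [Phi a * _]mulrC.
rewrite opprB addrC addrA subrK distrC.
apply: dP => //.
- by move=> j; rewrite ltnS => jp; have /andP[/le_trans + vj] := vt j jp; apply.
(* The cell lies between t_(j-1) and t_(j+1), hence within one old mesh of t_j on either side. *)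
- move=> j x; rewrite ltnS => jp /andP[vx xv]; rewrite ltr_norml; apply/andP; split.
    move: jp; rewrite leq_eqVlt => /predU1P[jp|jp].
      by move: xv; rewrite jp vp tp; lra.
    by have [_] := ts j jp; have := td j jp; move: xv; rewrite vS//; lra.
  case: j jp vx {xv} => [|j] jp vx; first by move: vx; rewrite t0 /v/=; lra.
  by have [+ _] := ts j jp; have := td j jp; move: vx; rewrite vS//; lra.
Qed.

End riemann_stieltjes.

(** * The Marcinkiewicz integral *)

Section ftc.
Context {R : realType}.
Notation mu := (@lebesgue_measure R).

Lemma integral_derivative (f F : R -> R) (a b : R) : a <= b ->
  (forall x, a <= x <= b -> is_derive x 1 F (f x)) ->
  (forall x, a <= x <= b -> {for x, continuous f}) ->
  (\int[mu]_(x in `[a, b]) (f x)%:E)%E = (F b - F a)%:E.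
Proof.
rewrite le_eqVlt => /predU1P[<- _ _|ab dF cf].
  by rewrite set_itv1 integral_set1 subrr.
have cF x : a <= x <= b -> {for x, continuous F}.
  move=> /dF dFx; apply: differentiable_continuous; apply/derivable1_diffP.
  by [].
rewrite (@continuous_FTC2 _ f F)//.
- apply: continuous_in_subspaceT => x /set_mem; rewrite /= in_itv/=; exact: cf.
- split.
  + by move=> x; rewrite in_itv/= => /andP[ax xb]; have := dF x; rewrite !ltW// => /(_ isT).
  + by apply: cvg_at_right_filter; apply: cF; rewrite lexx ltW.
  + by apply: cvg_at_left_filter; apply: cF; rewrite lexx ltW.
- move=> x; rewrite in_itv/= => /andP[ax xb]; rewrite derive1E.
  by have := dF x; rewrite !ltW// => /(_ isT) ?; exact: derive_val.
Qed.

Lemma Rintegral_derivative (f F : R -> R) (a b : R) : a <= b ->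
  (forall x, a <= x <= b -> is_derive x 1 F (f x)) ->
  (forall x, a <= x <= b -> {for x, continuous f}) ->
  \int[mu]_(x in `[a, b]) f x = F b - F a.
Proof. by move=> ab dF cf; rewrite /Rintegral (integral_derivative ab dF cf). Qed.

Lemma is_derive_invB (y x : R) : x != y ->
  is_derive x 1 (fun z => - (z - y)^-1) ((x - y) ^- 2).
Proof.
move=> xy; have xy0 : x - y != 0 by rewrite subr_eq0.
have h : is_derive x (1 : R) (fun z => z - y) 1.
  by apply: (is_derive_eq (is_deriveB _ _)); rewrite subr0.
have hV : is_derive x 1 (fun z => (z - y)^-1) ((- (x - y) ^- 2) *: 1).
  exact: (@is_deriveV _ (fun z : R => z - y) x 1 1 xy0 h).
have hh : is_derive x 1 (fun z => - (z - y)^-1) (- ((- (x - y) ^- 2) *: 1)).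
  exact: (is_deriveN hV).
by apply: (is_derive_eq hh); rewrite scaleNr opprK [LHS]mulr1.
Qed.

Lemma continuous_invsqB (y x : R) : x != y ->
  {for x, continuous (fun z : R => (z - y) ^- 2)}.
Proof.
move=> xy; have xy0 : (x - y) ^+ 2 != 0 by rewrite expf_neq0// subr_eq0.
apply: (@continuousV _ _ (fun z => (z - y) ^+ 2)) => //.
apply: (@continuous_comp _ _ _ (fun z : R => z - y) (fun z => z ^+ 2)).
  by apply: cvgB; [exact: cvg_id|exact: cvg_cst].
exact: exprn_continuous.
Qed.

(** Each of the two sides contributes 1 / s - 1 / r if s <= r; otherwise the domain is empty. *)
Lemma integral_invsq_le (y s r : R) : 0 < s ->
  (\int[mu]_(x in [set x | s <= `|y - x| <= r]%R) ((y - x) ^- 2)%:E <= (2 / s)%:E)%E.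
Proof.
move=> s0; have [sr|rs] := leP s r; last first.
  rewrite (_ : [set x | _]%R = set0) ?integral_set0 ?lee_fin ?divr_ge0 ?ltW//.
  apply/seteqP; split => // x /= /andP[sx xr].
  by move: (le_trans sx xr); rewrite leNgt rs.
have r0 : 0 < r by exact: lt_le_trans sr.
have -> : [set x : R | s <= `|y - x| <= r] = `[y - r, y - s] `|` `[y + s, y + r]%classic.
  apply/seteqP; split => x /=; rewrite !in_itv/=.
    move=> /andP[]; rewrite ler_norml ler_normr => /orP[] sx /andP[xr xr']; [left|right];
      by apply/andP; split; lra.
  by rewrite ler_norml ler_normr => -[]/andP[? ?]; apply/andP;
    split; [apply/orP; left| |apply/orP; right|]; try (apply/andP; split); lra.
have cont x : x != y -> {for x, continuous (fun z : R => (y - z) ^- 2)}.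
  move=> xy; rewrite (_ : (fun z => _) = (fun z => (z - y) ^- 2)).
    exact: continuous_invsqB.
  by apply/funext => z; rewrite -sqrrN opprB.
have der x : x != y -> is_derive x (1 : R) (fun z => - (z - y)^-1) ((y - x) ^- 2).
  by move=> xy; rewrite -sqrrN opprB; exact: is_derive_invB.
rewrite ge0_integral_setU//=; last 3 first.
- apply/measurable_EFinP; apply: measurable_funTS; apply: measurable_funV.
  by apply: measurable_funX; exact: measurable_funB.
- by move=> x _; rewrite lee_fin invr_ge0 sqr_ge0.
- apply/disj_setPS => x [/=]; rewrite !in_itv/= => /andP[_ h1] /andP[h2 _]; lra.
rewrite (integral_derivative (_ : y - r <= y - s) (fun x _ => der x _) (fun x _ => cont x _)); last 3 first.
- lra.
- by move=> x /andP[h1 h2]; rewrite lt_eqF//; lra.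
- by move=> x /andP[h1 h2]; rewrite lt_eqF//; lra.
rewrite (integral_derivative (_ : y + s <= y + r) (fun x _ => der x _) (fun x _ => cont x _)); last 3 first.
- lra.
- by move=> x /andP[h1 h2]; rewrite gt_eqF//; lra.
- by move=> x /andP[h1 h2]; rewrite gt_eqF//; lra.
rewrite -EFinD lee_fin.
rewrite (_ : y - s - y = - s); last ring.
rewrite (_ : y - r - y = - r); last ring.
rewrite (_ : y + s - y = s); last ring.
rewrite (_ : y + r - y = r); last ring.
rewrite !invrN !opprK.
have : 0 < r^-1 by rewrite invr_gt0.
lra.
Qed.

End ftc.

Section marcinkiewicz.
Context {R : realType}.
Notation mu := (@lebesgue_measure R).
Variables (b : R -> R) (F : set R) (C r : R).
Hypotheses (mb : measurable_fun setT b) (b0 : forall y, 0 <= b y).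
Hypotheses (mF : measurable F) (C0 : 0 < C).
Hypothesis bF : forall x y, F x -> b y <= C * `|y - x|.

(** Bounded pieces of [F]: a point y within r of [A n] lies in a bounded interval, which makes the
    double integral finite. *)
Let A n : set (measurableTypeR R) := F `&` `[- n%:R, n%:R].
Let T : Type := (measurableTypeR R * measurableTypeR R)%type.
Let D : set T := [set z : T | (`|z.2 - z.1| : R) <= r].
Let f n (z : T) : R := \1_(A n) z.1 * \1_D z * (b z.2 * (z.2 - z.1) ^- 2).

Let mA n : measurable (A n).
Proof. exact: measurableI. Qed.

Let mD : measurable D.
Proof.
apply: measurable_le_set => //.
by apply: measurableT_comp => //; exact: measurable_funB.
Qed.

Let mf n : measurable_fun setT (f n).
Proof.
apply: measurable_funM; first apply: measurable_funM.
- have m1 : measurable_fun [set: measurableTypeR R] (\1_(A n) : _ -> R).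
    exact: measurable_indic.
  exact: measurableT_comp m1 measurable_fst.
- exact: measurable_indic.
- apply: measurable_funM; first exact: measurableT_comp.
  apply: measurableT_comp; first exact: invr_measurable.
  by apply: measurable_funX; exact: measurable_funB.
Qed.

Let f0 n z : 0 <= f n z.
Proof. by rewrite !mulr_ge0// invr_ge0 sqr_ge0. Qed.

Let mf1 n y : measurable_fun setT (fun x => f n (x, y)).
Proof. by apply: (measurableT_comp (mf n)); exact: pair2_measurable. Qed.

Let mf2 n x : measurable_fun setT (fun y => f n (x, y)).
Proof. by apply: (measurableT_comp (mf n)); exact: pair1_measurable. Qed.

Let mk y (E : set R) : measurable_fun E (fun x => (y - x) ^- 2).
Proof.
apply: measurable_funTS; apply: measurable_funV.
by apply: measurable_funX; exact: measurable_funB.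
Qed.

Let inner_le n y : (\int[mu]_x (f n (x, y))%:E <=
  (2 * C)%:E * (\1_(`[- (n%:R + r), n%:R + r]) y)%:E)%E.
Proof.
have [yn|yn] := boolP (y \in (`[- (n%:R + r), n%:R + r]%classic : set R)); last first.
  rewrite integral0_eq; first by rewrite mule_ge0// lee_fin// mulr_ge0// ltW.
  move=> x _; rewrite /f /=; apply/congr1.
  have [xA|xA] := boolP (x \in A n); last by rewrite indicE (negPf xA) !mul0r.
  rewrite [X in _ * X * _]indicE memNset ?mulr0 ?mul0r// /D/=.
  move: xA => /set_mem[_]/=; rewrite in_itv/= => /andP[x1 x2].
  rewrite ler_norml => /andP[y1 y2]; move: yn => /negP; apply.
  by rewrite inE/= in_itv/=; apply/andP; split; lra.
rewrite indicE yn mule1.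
have := b0 y; rewrite le_eqVlt => /predU1P[by0|by0].
  rewrite integral0_eq ?lee_fin ?mulr_ge0 ?ltW//.
  by move=> x _; rewrite /f/= -by0 mul0r mulr0.
pose E : set R := [set x | (b y / C <= `|y - x|) && (`|y - x| <= r)].
have mE : measurable E.
  rewrite (_ : E = [set x | b y / C <= `|y - x|] `&` [set x | `|y - x| <= r]).
    apply: measurableI; apply: measurable_le_set => //;
      by apply: measurableT_comp => //; exact: measurable_funB.
  by apply/seteqP; split => x /=; [move/andP|move=> [? ?]; exact/andP].
apply: (@le_trans _ _ (\int[mu]_(x in E) ((b y)%:E * ((y - x) ^- 2)%:E))%E).
  rewrite [leRHS]integral_mkcond; apply: ge0_le_integral => //.
  - by move=> x _; rewrite lee_fin f0.
  - by apply/measurable_EFinP; exact: mf1.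
  - apply/(measurable_restrictT _ _).1 => //.
    by apply: emeasurable_funM => //; apply/measurable_EFinP; exact: mk.
  move=> x _; rewrite /patch; case: ifPn => xE.
    by rewrite -EFinM lee_fin /f/= ler_piMl ?mulr_ge0 ?invr_ge0 ?sqr_ge0//.
  rewrite (_ : point = 0%E)//.
  rewrite lee_fin /f/=.
  have [xA|xA] := boolP (x \in A n); last by rewrite indicE (negPf xA) !mul0r.
  rewrite [X in _ * X * _]indicE memNset ?mulr0 ?mul0r// /D/= => yr.
  move: xE => /negP; apply; rewrite inE /E/= yr andbT.
  move: xA => /set_mem[Fx _]; rewrite ler_pdivrMr// mulrC; exact: bF.
rewrite ge0_integralZl_EFin//; first last.
- by apply/measurable_EFinP; exact: mk.
- by move=> x _; rewrite lee_fin invr_ge0 sqr_ge0.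
apply: (@le_trans _ _ ((b y)%:E * (2 / (b y / C))%:E)%E).
  by rewrite lee_wpmul2l ?lee_fin// integral_invsq_le// divr_gt0.
rewrite -EFinM lee_fin le_eqVlt; apply/orP; left; apply/eqP.
by field; rewrite !gt_eqF.
Qed.

(* Tonelli: integrating over x in F first, the kernel (y - x)^-2 is cut off at
   |y - x| >= b y / C, so that the inner integral is at most 2 C / b y. *)
Lemma marcinkiewicz_ae : {ae mu, forall x, F x ->
  (\int[mu]_(y in `[(x - r)%R, (x + r)%R]) (b y * (y - x) ^- 2)%:E < +oo)%E}.
Proof.
suff aen n : {ae mu, forall x, A n x ->
    (\int[mu]_(y in `[(x - r)%R, (x + r)%R]) (b y * (y - x) ^- 2)%:E < +oo)%E}.
  have : {ae mu, forall x n, A n x ->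
    (\int[mu]_(y in `[(x - r)%R, (x + r)%R]) (b y * (y - x) ^- 2)%:E < +oo)%E}.
    exact: ae_foralln.
  move=> /lebesgue_aeS; apply => x + Fx.
  move=> /(_ (Num.truncn `|x|).+1); apply; split => //=.
  rewrite in_itv/= -ler_norml ltW//; exact: Num.Theory.truncnS_gt.
have mef : measurable_fun setT (EFin \o f n) by exact/measurable_EFinP.
have ef0 z : (0 <= (EFin \o f n) z)%E by rewrite /= lee_fin.
have fin : (\int[mu]_x \int[mu]_y (EFin \o f n) (x, y) < +oo)%E.
  rewrite (@fubini_tonelli _ _ _ _ _ mu mu (EFin \o f n))//.
  apply: (@le_lt_trans _ _ (\int[mu]_y
      ((2 * C)%:E * (\1_(`[- (n%:R + r), n%:R + r]%classic : set R) y)%:E))%E).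
    apply: ge0_le_integral => //.
    - by move=> y _; apply: integral_ge0 => x _; exact: ef0.
    - exact: measurable_fun_fubini_tonelli_G.
    - by apply: emeasurable_funM => //; apply/measurable_EFinP; exact: measurable_indic.
    - by move=> y _; exact: inner_le.
  rewrite ge0_integralZl_EFin//; last 2 first.
  - by apply/measurable_EFinP; exact: measurable_indic.
  - by rewrite mulr_ge0// ltW.
  rewrite integral_indic// setIT lte_mul_pinfty ?lee_fin ?mulr_ge0 ?ltW//.
  by rewrite /= lebesgue_measure_itv/=; case: ifPn => _; rewrite ?ltry// -EFinB ltry.
have mg := @measurable_fun_fubini_tonelli_F _ _ _ _ _ mu (EFin \o f n) mef ef0.
have intg : mu.-integrable setT (fun x => \int[mu]_y (EFin \o f n) (x, y))%E.
  apply/integrableP; split => //.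
  under eq_integral do rewrite gee0_abs ?integral_ge0//.
  exact: fin.
have := integrable_ae _ intg; move=> /(_ measurableT) /lebesgue_aeS; apply.
move=> x /(_ Logic.I); rewrite ge0_fin_numE; last by apply: integral_ge0.
move=> fx Ax; apply: le_lt_trans fx.
rewrite integral_mkcond; apply: ge0_le_integral => //.
- move=> y _; rewrite /patch; case: ifPn => // _.
  by rewrite lee_fin mulr_ge0 ?invr_ge0 ?sqr_ge0.
- apply/(measurable_restrictT _ _).1 => //; apply/measurable_EFinP.
  apply: measurable_funTS; apply: measurable_funM => //; apply: measurable_funV.
  by apply: measurable_funX; exact: measurable_funB.
- by apply/measurable_EFinP; exact: mf2.
move=> y _; rewrite /patch/=; case: ifPn => yx; last by rewrite lee_fin f0.
rewrite /f/= indicE mem_set// mul1r indicE mem_set ?mul1r// /D/=.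
by move: yx; rewrite inE/= in_itv/= ler_norml => /andP[? ?]; apply/andP; split; lra.
Qed.

End marcinkiewicz.

(** * The conjugate function of a Lipschitz function *)

Section trig_bounds.
Context {R : realType}.
Implicit Types t z : R.

Lemma cos_quarter_sqr : cos (pi / 4) ^+ 2 = 2^-1 :> R.
Proof.
have := cos_mulr2n (pi / 4 : R).
rewrite (_ : pi / 4 *+ 2 = pi / 2); last by rewrite mulr2n; field.
by rewrite cos_pihalf [_ ^+ 2 *+ 2]mulr2n; lra.
Qed.

(** In sin z = 2 sin (z / 2) cos (z / 2), the cosine is at least cos (pi / 4), and by the mean value
    theorem so is sin (z / 2) divided by z / 2; the square of cos (pi / 4) is 1 / 2. *)
Lemma sin_ge_half z : 0 <= z <= pi / 2 -> z / 2 <= sin z.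
Proof.
move=> /andP[z0 zpi]; have pi0 : 0 < pi :> R := pi_gt0 R.
have w0 : 0 <= z / 2 by lra.
have wpi : z / 2 <= pi / 4 by lra.
have c0 : 0 <= cos (pi / 4 : R) by apply: cos_ge0_pihalf; apply/andP; split; lra.
have cosle u : 0 <= u <= z / 2 -> cos (pi / 4) <= cos u.
  move=> /andP[u0 u1]; rewrite leNgt ltr_cos -?leNgt; [lra| |];
    by rewrite in_itv/=; apply/andP; split; lra.
have sinw : (z / 2) * cos (pi / 4) <= sin (z / 2).
  have [c + ] := @MVT_segment _ (@sin R) (@cos R) 0 (z / 2) w0
    (fun x _ => is_derive_sin x) (continuous_subspaceT (@continuous_sin R)).
  rewrite in_itv/= sin0 !subr0 => /cosle cc ->.
  by rewrite mulrC ler_wpM2r.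
have cw : cos (pi / 4) <= cos (z / 2) by apply: cosle; rewrite w0 lexx.
have -> : sin z = 2 * (sin (z / 2) * cos (z / 2)).
  have := sin_mulr2n (z / 2); rewrite (_ : z / 2 *+ 2 = z); last by rewrite mulr2n; field.
  by move=> ->; rewrite mulr2n; ring.
have : (z / 2) * cos (pi / 4) * cos (pi / 4) <= sin (z / 2) * cos (z / 2).
  by apply: ler_pM => //; rewrite mulr_ge0.
rewrite -mulrA -expr2 cos_quarter_sqr; lra.
Qed.

Lemma sin_le_norm z : `|sin z| <= `|z|.
Proof.
wlog z0 : z / 0 <= z.
  move=> h; have [/h//|z0] := leP 0 z.
  by rewrite -normrN -sinN -[leRHS]normrN h// oppr_ge0 ltW.
have [c _ ] := @MVT_segment _ (@sin R) (@cos R) 0 z z0 (fun x _ => is_derive_sin x)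
   (continuous_subspaceT (@continuous_sin R)).
rewrite sin0 !subr0 => ->; rewrite normrM ler_piMl//; exact: cos_max.
Qed.

Lemma sin_half_ge t : 0 <= t <= pi -> t / 4 <= sin (t / 2).
Proof.
move=> /andP[t0 tpi]; have := @sin_ge_half (t / 2).
by rewrite -mulrA -invfM -natrM; apply; apply/andP; split; lra.
Qed.

Lemma norm_sin_half_ge t : `|t| <= pi -> `|t| / 4 <= `|sin (t / 2)|.
Proof.
have [t0|t0] := leP 0 t => tpi.
  rewrite ger0_norm// in tpi *.
  by rewrite (le_trans (sin_half_ge _)) ?ler_norm// t0.
rewrite ltr0_norm// in tpi *; rewrite -normrN -sinN -mulNr (le_trans (sin_half_ge _)) ?ler_norm//.
by rewrite oppr_ge0 ltW//=.
Qed.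

Lemma cosE_half t : 1 - cos t = 2 * sin (t / 2) ^+ 2.
Proof.
have := cos_mulr2n (t / 2); rewrite (_ : t / 2 *+ 2 = t); last by rewrite mulr2n; field.
by move=> ->; rewrite cos2sin2 mulr2n; ring.
Qed.

Lemma cosB_prod y z : cos y - cos z = 2 * (sin ((z + y) / 2) * sin ((z - y) / 2)).
Proof.
rewrite -[in LHS](_ : (z + y) / 2 - (z - y) / 2 = y); last by field.
rewrite -[in X in _ - X](_ : (z + y) / 2 + (z - y) / 2 = z); last by field.
by rewrite cosB cosD; ring.
Qed.

Lemma oneBcos_le t : 1 - cos t <= t ^+ 2 / 2.
Proof.
rewrite cosE_half -(real_normK (num_real (sin _))).
have : `|sin (t / 2)| ^+ 2 <= `|t / 2| ^+ 2 by rewrite lerXn2r ?nnegrE// sin_le_norm.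
by rewrite (real_normK (num_real (t / 2))) expr_div_n; lra.
Qed.

Lemma oneBcos_ge t : `|t| <= pi -> t ^+ 2 / 8 <= 1 - cos t.
Proof.
move=> tpi; rewrite cosE_half -(real_normK (num_real (sin _))).
have : (`|t| / 4) ^+ 2 <= `|sin (t / 2)| ^+ 2.
  by rewrite lerXn2r ?nnegrE// ?divr_ge0// norm_sin_half_ge.
by rewrite expr_div_n (real_normK (num_real t)); lra.
Qed.

Lemma kapB_prod s t : sin (s / 2) != 0 -> sin (t / 2) != 0 ->
  kap t - kap s = sin ((s - t) / 2) / (sin (s / 2) * sin (t / 2)).
Proof. by move=> s0 t0; rewrite /kap mulrBl sinB; field; rewrite s0 t0. Qed.

Lemma measurable_kap : measurable_fun setT (@kap R).
Proof.
rewrite /kap; apply: measurable_funM.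
  apply: continuous_measurable_fun => x.
  apply: (@continuous_comp _ _ _ (fun t : R => t / 2) cos); last exact: continuous_cos.
  exact: mulrr_continuous.
apply: measurable_funV; apply: continuous_measurable_fun => x.
apply: (@continuous_comp _ _ _ (fun t : R => t / 2) sin); last exact: continuous_sin.
exact: mulrr_continuous.
Qed.

End trig_bounds.

Section conjugate_function.
Context {R : realType}.
Notation mu := (@lebesgue_measure R).
Variables (G : R -> R) (M : R).
Hypotheses (pG : periodic G (2 * pi)) (M0 : 0 <= M).
Hypothesis GM : forall x y, `|G x - G y| <= M * `|x - y|.

Let pi0 : 0 < pi :> R := pi_gt0 R.

Lemma lip_continuous : continuous G.
Proof.
move=> x; apply/cvgrPdist_le => e e0; near=> y.
rewrite (le_trans (GM _ _))// -[e](@mulfVK _ (M + 1)) ?gt_eqF ?ltr_wpDl//.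
rewrite mulrC ler_pM//; last by rewrite lerDl.
by near: y; apply: cvgr_dist_le; [exact: cvg_id|rewrite divr_gt0// ltr_wpDl].
Unshelve. all: by end_near. Qed.

Lemma measurable_lip : measurable_fun setT G.
Proof. exact: continuous_measurable_fun lip_continuous. Qed.

(** Makes the numerator of [conj_ker] vanish with the sine in its denominator. Both sides have
    period 2 pi in t, and |t| <= 4 |sin (t / 2)| on [- pi, pi]. *)
Lemma lip_sin_le x t : `|G (x - t) - G x| <= 4 * M * `|sin (t / 2)|.
Proof.
wlog t0 : x t / 0 <= t.
  move=> h; have [/h//|t0] := leP 0 t.
  have := h (x - t) (- t); rewrite opprK subrK distrC mulNr sinN normrN; apply.
  by rewrite oppr_ge0 ltW.
have [n [s [s0 s2 ->]]] : exists n s, [/\ 0 <= s, s <= 2 * pi & t = s + 2 * pi *+ n].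
  pose n := Num.truncn (t / (2 * pi)).
  have /andP[n1 n2] : n%:R <= t / (2 * pi) < n.+1%:R.
    by apply: Num.Theory.truncn_itv; rewrite divr_ge0// mulr_ge0// ltW.
  exists n, (t - 2 * pi *+ n); split; last by rewrite subrK.
    by rewrite subr_ge0 -mulr_natl -ler_pdivlMr// mulr_gt0.
  rewrite lerBlDl addrC -mulrS -[_ *+ n.+1]mulr_natl -ler_pdivrMr ?mulr_gt0//.
  exact: ltW.
have -> : G (x - (s + 2 * pi *+ n)) = G (x - s).
  by rewrite -[LHS](periodicn pG n); congr G; rewrite opprD addrA subrK.
have -> : `|sin ((s + 2 * pi *+ n) / 2)| = `|sin (s / 2)|.
  rewrite mulrDl (_ : _ *+ n / 2 = pi *+ n); last by rewrite mulrnAl mulrAC divff ?pnatr_eq0// mul1r.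
  elim: n => [|n IH]; first by rewrite addr0.
  by rewrite [pi *+ n.+1]mulrSr addrA sinDpi normrN.
have [spi|spi] := leP s pi.
  rewrite (le_trans (GM _ _))// (_ : x - s - x = - s); last by ring.
  rewrite normrN -mulrA mulrCA ler_wpM2l// -ler_pdivrMl// mulrC norm_sin_half_ge//.
  by rewrite ger0_norm.
have -> : G (x - s) = G (x - (s - 2 * pi)).
  by rewrite -[LHS]pG; congr G; ring.
have -> : `|sin (s / 2)| = `|sin ((s - 2 * pi) / 2)|.
  rewrite (_ : s / 2 = (s - 2 * pi) / 2 + pi); last by field.
  by rewrite sinDpi normrN.
rewrite (le_trans (GM _ _))// (_ : x - (s - 2 * pi) - x = - (s - 2 * pi)); last by ring.
rewrite normrN -mulrA mulrCA ler_wpM2l// -ler_pdivrMl// mulrC norm_sin_half_ge//.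
by rewrite ler_norml; apply/andP; split; lra.
Qed.

Definition conj_ker x t : R := (G (x - t) - G x) * kap t.

Lemma conj_ker_le x t : `|conj_ker x t| <= 4 * M.
Proof.
rewrite /conj_ker /kap normrM.
have [->|s0] := eqVneq (sin (t / 2)) 0.
  by rewrite invr0 mulr0 normr0 mulr0 mulr_ge0.
rewrite normrM normfV mulrA ler_pdivrMr ?normr_gt0//.
rewrite (le_trans _ (lip_sin_le x t))// ler_piMr//; exact: cos_max.
Qed.

Lemma measurable_conj_ker x : measurable_fun setT (conj_ker x).
Proof.
apply: measurable_funM measurable_kap; apply: measurable_funB => //.
by apply: measurableT_comp; [exact: measurable_lip|exact: measurable_funB].
Qed.

(** 3 = 1 + 4 / 2: in the second term sin (s / 2) cancels by [lip_sin_le]. Only sin (t / 2) remains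
    below, so t alone has to stay away from the pole. *)
Lemma conj_ker_lip x t s : sin (t / 2) != 0 -> sin (s / 2) != 0 ->
  `|conj_ker x t - conj_ker x s| <= 3 * M / `|sin (t / 2)| * `|t - s|.
Proof.
move=> t0 s0; rewrite /conj_ker.
have -> : (G (x - t) - G x) * kap t - (G (x - s) - G x) * kap s =
  (G (x - t) - G (x - s)) * kap t + (G (x - s) - G x) * (kap t - kap s) by ring.
rewrite (le_trans (ler_normD _ _))// !normrM.
have -> : 3 * M / `|sin (t / 2)| * `|t - s| =
   M * `|t - s| * `|sin (t / 2)|^-1 +
   4 * M * `|sin (s / 2)| * ((`|t - s| / 2) / (`|sin (s / 2)| * `|sin (t / 2)|)).
  by field; rewrite !normr_eq0 t0 s0.
apply: lerD.
  apply: ler_pM => //.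
    by rewrite (le_trans (GM _ _))// (_ : x - t - (x - s) = - (t - s)) ?normrN//; ring.
  by rewrite normfV ler_piMl ?invr_ge0// cos_max.
apply: ler_pM => //; first exact: lip_sin_le.
rewrite kapB_prod// normrM normfV normrM ler_wpM2r ?invr_ge0 ?mulr_ge0//.
by rewrite (le_trans (sin_le_norm _))// normrM (ger0_norm (_ : 0 <= 2^-1)) ?invr_ge0// distrC.
Qed.

Lemma sin_half_ge2 (t d : R) : 0 <= d -> d <= t <= 2 * pi - d -> d / 4 <= sin (t / 2).
Proof.
move=> d0 /andP[dt td]; have [tpi|tpi] := leP t pi.
  rewrite (le_trans _ (sin_half_ge _))//; first lra.
  by rewrite tpi (le_trans d0).
have -> : sin (t / 2) = sin ((2 * pi - t) / 2).
  by rewrite (_ : (2 * pi - t) / 2 = - (t / 2) + pi) ?sinDpi ?sinN ?opprK//; field.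
rewrite (le_trans _ (sin_half_ge _))//; first lra.
by apply/andP; split; lra.
Qed.

Lemma conj_ker_modulus x : ae_modulus (conj_ker x) (conj_ker x) 0 (2 * pi).
Proof.
move=> eta eta0; pose d := Num.min (eta / 2) 1.
have d0 : 0 < d by rewrite lt_min ltr01 andbT divr_gt0.
have de : d <= eta / 2 by rewrite ge_min lexx.
pose K := 3 * M / (d / 4) + 1.
have d4 : 0 < d / 4 by rewrite divr_gt0.
have K0 : 0 < K.
  rewrite ltr_wpDl//; apply: divr_ge0; last exact: ltW.
  by rewrite mulr_ge0.
(* The excluded set has measure 2 d <= eta. A distance below d keeps s inside ]0, 2 pi[, where sin
   (s / 2) > 0; eta / K serves the Lipschitz bound. *)
exists `[d, 2 * pi - d]%classic, (Num.min d (eta / K)); split.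
- exact: measurable_itv.
- by rewrite lt_min d0 divr_gt0.
- apply: (@le_trans _ _ (mu (`[0, d] `|` `[2 * pi - d, 2 * pi]))).
    apply: le_measure; rewrite ?inE//.
    + by apply: measurableI => //; exact: measurableC.
    + exact: measurableU.
    + move=> z [/=]; rewrite !in_itv/= => /andP[z0 z1] zd.
      have [zd'|zd'] := leP z d; [left|right]; apply/andP; split => //.
      by have [//|h] := leP (2 * pi - d) z; exfalso; apply: zd; rewrite !ltW.
  apply: (le_trans (measureU2 _ _ _)) => //.
  rewrite /= !lebesgue_measure_itv/= !lte_fin d0.
  rewrite ltrBlDr ltrDl d0 -!EFinB -EFinD lee_fin; lra.
- move=> t s; rewrite /= in_itv/= => td _ /andP[s0 s2]; rewrite lt_min => /andP[std stK].
  have sint := sin_half_ge2 (ltW d0) td.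
  have sint0 : 0 < sin (t / 2) by apply: lt_le_trans sint; rewrite divr_gt0.
  have sins : sin (s / 2) != 0.
    rewrite gt_eqF//; apply: sin_gt0_pi; move: td std; rewrite ltr_norml => /andP[? ?] /andP[? ?].
    by apply/andP; split; lra.
  rewrite distrC (le_trans (conj_ker_lip x (lt0r_neq0 sint0) sins))//.
  rewrite distrC.
  apply: (@le_trans _ _ (K * (eta / K))); last by rewrite mulrCA divff ?gt_eqF ?mulr1.
  apply: ler_pM => //; [by rewrite divr_ge0 ?mulr_ge0| |exact: ltW].
  rewrite /K (ger0_norm (ltW sint0)) ler_wpDr// ler_wpM2l ?mulr_ge0//.
  by rewrite lef_pV2 ?posrE// divr_gt0.
Qed.

(* 2 pi times the conjugate function of G; subtracting G x, which does not
   change the principal value since [kap] is odd, makes the integrand bounded. *)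
Definition conj_fun x : R := \int[mu]_(t in `[0, 2 * pi]) conj_ker x t.

(** Subtracting G x is free, since the midpoint sum of [kap] vanishes. *)
Lemma conj_sumE0 N x : (0 < N)%N ->
  conj_sum G N x = 2 * pi / N%:R *
    \sum_(0 <= j < N) conj_ker x (2 * pi / N%:R * (j%:R + 2^-1)).
Proof.
move=> N0; rewrite /conj_sum; congr (_ * _).
have := @psum_kap0 R N 0 N0; rewrite mulr0 subr0 => k0.
rewrite /conj_ker /psum; under [RHS]eq_bigr do rewrite mulrBl.
rewrite sumrB -[X in _ - X]mulr_sumr.
have pt j : 2 * pi / N%:R / 2 + 2 * pi / N%:R * j%:R = 2 * pi / N%:R * (j%:R + 2^-1) :> R.
  by ring.
under [X in _ = _ - _ * X]eq_bigr do rewrite -pt.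
under [X in _ = X - _]eq_bigr do rewrite -pt.
by rewrite -/(psum kap N _) k0 mulr0 subr0.
Qed.

Lemma cvg_conj_sum x : conj_sum G N x @[N --> \oo] --> conj_fun x.
Proof.
apply/cvgrPdist_lt => e e0.
have pi20 : 0 <= 2 * pi :> R by rewrite mulr_ge0// ltW.
have M40 : 0 <= 4 * M by rewrite mulr_ge0.
(* Plain Riemann sums are the case of the weight 1, whose primitive is the identity. *)
have w1 (y : R) : 0 <= y <= 2 * pi -> `|cst (1 : R) y| <= 1 by rewrite normr1.
have k1 (u v : R) : 0 <= u -> u <= v -> v <= 2 * pi ->
    v - u = \int[mu]_(y in `[u, v]) (cst (1 : R) y).
  by move=> _ uv _; rewrite Rintegral_itv_cst// mul1r.
have [d d0 dP] := weighted_sum_cvg pi20 M40 ler01 (conj_ker_le x) (conj_ker_le x)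
  (measurable_conj_ker x) (measurable_cst _) w1 k1 (conj_ker_modulus x) e0.
near=> N.
have N1 : (0 < N)%N by near: N; exact: nbhs_infty_gt.
rewrite distrC conj_sumE0// mulr_sumr.
have N0 : 0 < N%:R :> R by rewrite ltr0n.
have dN : 2 * pi / N%:R < d.
  by rewrite ltr_pdivrMr// -ltr_pdivrMl//; near: N; exact: nbhs_infty_gtr.
have := dP N (fun j => 2 * pi / N%:R * j%:R) (fun j => 2 * pi / N%:R * (j%:R + 2^-1)).
rewrite mulr0 divfK ?gt_eqF// => /(_ erefl erefl).
have S j : 2 * pi / N%:R * j.+1%:R = 2 * pi / N%:R * j%:R + 2 * pi / N%:R :> R.
  by rewrite -(natr1 j); ring.
have dl0 : 0 < 2 * pi / N%:R :> R by rewrite divr_gt0// mulr_gt0.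
rewrite /conj_fun; under [X in _ -> _ -> _ -> `|_ - X| < _]eq_Rintegral do rewrite mulr1.
have S' j : 2 * pi / N%:R * j.+1%:R - 2 * pi / N%:R * j%:R = 2 * pi / N%:R :> R.
  by rewrite S addrAC subrr add0r.
under eq_bigr do rewrite S' mulrC.
apply.
- by move=> j _; rewrite S lerDl ltW.
- move=> j jN; apply/andP; split; first by rewrite mulr_ge0// ltW.
  apply: (@le_trans _ _ (2 * pi / N%:R * N%:R)); last by rewrite divfK ?gt_eqF.
  rewrite ler_wpM2l// ?(ltW dl0)// (@le_trans _ _ j.+1%:R) ?ler_nat// -(natr1 j) lerD2l; lra.
- move=> j y jN; rewrite S => /andP[h1 h2]; apply: le_lt_trans dN.
  rewrite mulrDr ler_norml; apply/andP; split; lra.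
Unshelve. all: by end_near. Qed.

Lemma continuous_conj_fun : continuous conj_fun.
Proof.
move=> x.
have := @continuity_under_integral R _ _ mu conj_ker `[0, 2 * pi]%classic (measurable_itv _) (x - 1) (x + 1).
move=> /(_ _ _ (cst (4 * M)) _ _ x); apply.
- move=> y _; apply: (@bounded_integrable_itv _ _ _ _ (4 * M)) => //.
    by apply: measurable_funTS; exact: measurable_conj_ker.
  by move=> t _; exact: conj_ker_le.
- apply: aeW => t _ y _; rewrite /conj_ker; apply: cvgMl.
  apply: cvgB; last exact: lip_continuous.
  apply: (@continuous_comp _ _ _ (fun z : R => z - t) G); last exact: lip_continuous.
  by apply: cvgB; [exact: cvg_id|exact: cvg_cst].
- exact: integrable_itv_cst.
- by move=> y _; apply: aeW => t _; exact: conj_ker_le.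
- by rewrite inE/= in_itv/=; apply/andP; split; lra.
Qed.

(** Limit of [conj_sum_coarse_diff] along N = 2^n (r + 1), for which the points of rank n stay on
    the grid. *)
Lemma conj_fun_dyadic c n :
  2 ^+ n * \sum_(0 <= j < 2 ^ n)
    (conj_fun (c + 2 * pi * (j.+1%:R / 2 ^+ n)) - conj_fun (c + 2 * pi * (j%:R / 2 ^+ n))) ^+ 2 <=
  16 * pi ^+ 4 * M ^+ 2.
Proof.
rewrite -ler_pdivlMl ?exprn_gt0//.
have m0 : (0 < 2 ^ n)%N by rewrite expn_gt0.
have Nr x : conj_sum G (2 ^ n * r.+1) x @[r --> \oo] --> conj_fun x.
  apply: (@cvg_comp _ _ _ (fun r => 2 ^ n * r.+1)%N (fun N => conj_sum G N x) _ \oo).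
    apply/cvgnyPge => A; near=> r; apply: (@leq_trans r).
      by near: r; exact: nbhs_infty_ge.
    by rewrite (leq_trans (leqnSn r))// leq_pmull.
  exact: cvg_conj_sum.
have lim : \sum_(0 <= j < 2 ^ n)
    (conj_sum G (2 ^ n * r.+1) (c + 2 * pi * (j.+1%:R / 2 ^+ n)) -
     conj_sum G (2 ^ n * r.+1) (c + 2 * pi * (j%:R / 2 ^+ n))) ^+ 2 @[r --> \oo] -->
  \sum_(0 <= j < 2 ^ n) (conj_fun (c + 2 * pi * (j.+1%:R / 2 ^+ n)) -
     conj_fun (c + 2 * pi * (j%:R / 2 ^+ n))) ^+ 2.
  apply: cvg_big => [|j _]; first exact: add_continuous.
  by rewrite expr2; under eq_fun do rewrite expr2; apply: cvgM; apply: cvgB; exact: Nr.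
apply: (@cvgr_to_le _ _ _ _ _ _ _ lim); near=> r.
have := conj_sum_coarse_diff c m0 (ltn0Sn r) pG GM.
rewrite natrX [leRHS]mulrC; congr (_ <= _); apply: eq_bigr => j _; congr ((_ - _) ^+ 2);
  congr (conj_sum _ _ (_ + _)); ring.
Unshelve. all: by end_near. Qed.

Lemma derivable_conj_fun : {ae mu, forall x, derivable conj_fun x 1}.
Proof.
apply: derivable_ae_line continuous_conj_fun conj_fun_dyadic.
by rewrite mulr_gt0.
Qed.

(** The dyadic criterion again: increments at most M / 2^n give 2^n 2^n (M / 2^n)^2 = M^2. *)
Lemma derivable_lip : {ae mu, forall x, derivable G x 1}.
Proof.
apply: (@derivable_ae_line _ _ 1 (M ^+ 2) ltr01 lip_continuous) => a n.
have n0 : 0 < 2 ^+ n :> R by rewrite exprn_gt0.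
apply: (@le_trans _ _ (2 ^+ n * \sum_(0 <= j < 2 ^ n) (M / 2 ^+ n) ^+ 2)).
  rewrite ler_wpM2l ?(ltW n0)//; apply: ler_sum => j _.
  rewrite -[leLHS](real_normK (num_real _)) lerXn2r ?nnegrE ?divr_ge0 ?(ltW n0)//.
  apply: (le_trans (GM _ _)); rewrite le_eqVlt; apply/orP; left; apply/eqP.
  rewrite (_ : _ - _ = (2 ^+ n)^-1) ?ger0_norm ?invr_ge0 ?(ltW n0)//.
  by rewrite -(natr1 j); ring.
rewrite sumr_const_nat subn0 -[_ *+ (2 ^ n)%N]mulr_natr natrX le_eqVlt.
apply/orP; left; apply/eqP.
by field; rewrite gt_eqF.
Qed.

End conjugate_function.

(** * One-sided and symmetric difference quotients *)

Section symmetric_differences.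
Context {R : realType}.
Implicit Types f : R -> R.

Lemma derivable_cvg_right f (x : R) : derivable f x 1 ->
  (f (x + e) - f x) / e @[e --> 0^'+] --> ('D_1 f x : R).
Proof.
move=> df; have : h^-1 *: (f (h *: 1 + x) - f x) @[h --> 0^'] --> 'D_1 f x by exact: df.
move=> /cvgrPdist_lt h; apply/cvgrPdist_lt => eta eta0.
have [r /= r0 rP] := h _ eta0; exists r => //= z /= zr z0.
by have := rP z zr (lt0r_neq0 z0); rewrite [_ *: 1]mulr1 [_ *: _]mulrC [z + x]addrC.
Qed.

Lemma derivable_cvg_left f (x : R) : derivable f x 1 ->
  (f x - f (x - e)) / e @[e --> 0^'+] --> ('D_1 f x : R).
Proof.
move=> df; have : h^-1 *: (f (h *: 1 + x) - f x) @[h --> 0^'] --> 'D_1 f x by exact: df.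
move=> /cvgrPdist_lt h; apply/cvgrPdist_lt => eta eta0.
have [r /= r0 rP] := h _ eta0; exists r => //= z /=.
rewrite sub0r normrN => zr z0.
have := rP (- z); rewrite /= sub0r !normrN oppr_eq0 => /(_ zr (lt0r_neq0 z0)).
by rewrite [_ *: 1]mulr1 invrN scaleNr -scalerN opprB [_ *: _]mulrC [- z + x]addrC.
Qed.

Lemma derivable_cvg_sym f (x : R) : derivable f x 1 ->
  (f (x + e) - f (x - e)) / e @[e --> 0^'+] --> (2 * 'D_1 f x : R).
Proof.
move=> df; have := cvgD (derivable_cvg_right df) (derivable_cvg_left df).
rewrite -mulr2n -[_ *+ 2]mulr_natl => h; apply: cvg_trans (h _).
apply: near_eq_cvg; near=> e.
rewrite -[LHS]/((f (x + e) - f x) / e + (f x - f (x - e)) / e).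
by rewrite -mulrDl addrA subrK.
Unshelve. all: by end_near. Qed.

Lemma derivable_cvg_sym2 f (x : R) : derivable f x 1 ->
  (f (x + e) + f (x - e) - 2 * f x) / e @[e --> 0^'+] --> (0 : R).
Proof.
move=> df; have := cvgB (derivable_cvg_right df) (derivable_cvg_left df).
rewrite subrr => h; apply: cvg_trans (h _).
apply: near_eq_cvg; near=> e.
rewrite -[LHS]/((f (x + e) - f x) / e - (f x - f (x - e)) / e).
by rewrite -mulrBl; congr (_ / _); ring.
Unshelve. all: by end_near. Qed.

End symmetric_differences.

(** * Symmetric differences of the conjugate function *)

Section conjugate_symmetric.
Context {R : realType}.
Notation mu := (@lebesgue_measure R).
Variables (G : R -> R) (M : R).
Hypotheses (pG : periodic G (2 * pi)) (M0 : 0 <= M).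
Hypothesis GM : forall x y, `|G x - G y| <= M * `|x - y|.
Variable x : R.

Let pi0 : 0 < pi :> R := pi_gt0 R.
Let E (y : R) : R := G (x + y) + G (x - y) - 2 * G x.

Lemma periodic_conj_ker z : periodic (conj_ker G z) (2 * pi).
Proof.
move=> t; rewrite /conj_ker kapD2pi opprD addrA.
by rewrite -(pG (z - t - 2 * pi)) subrK.
Qed.

Lemma conj_fun_shift z s : `|s| <= pi ->
  conj_fun G z = \int[mu]_(t in `[- pi, pi]) conj_ker G z (t + s).
Proof.
rewrite ler_norml => /andP[s1 s2].
have pi20 : 0 <= 2 * pi :> R by rewrite mulr_ge0// ltW.
have c0 : 0 <= pi - s <= 2 * pi by apply/andP; split; lra.
have := Rintegral_periodic pi20 c0 (periodic_conj_ker z) (measurable_conj_ker M0 GM z)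
  (conj_ker_le pG M0 GM z) (s - pi).
rewrite (_ : s - pi + (pi - s) = 0) ?add0r; last by ring.
rewrite /conj_fun => ->.
rewrite (Rintegral_translation _ _ s); last exact: (measurable_conj_ker M0 GM z).
rewrite (_ : s - pi - s = - pi); last by ring.
by rewrite (_ : s - pi + 2 * pi - s = pi)//; ring.
Qed.

Lemma measurable_E : measurable_fun setT E.
Proof.
have mG := measurable_lip M0 GM.
apply: measurable_funB => //; apply: measurable_funD;
  apply: measurableT_comp => //; [exact: measurable_funD|exact: measurable_funB].
Qed.

Definition sym_ker (e y : R) : R := (E y - E e) * kap (e - y).

Lemma sym_kerE e y :
  sym_ker e y = conj_ker G (x + e) (e - y) - conj_ker G (x - e) (y - e).
Proof.
rewrite /sym_ker /conj_ker (_ : y - e = - (e - y)) ?kapN; last by rewrite opprB.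
rewrite (_ : x + e - (e - y) = x + y); last by ring.
rewrite (_ : x - e - - (e - y) = x - y); last by ring.
by rewrite /E; ring.
Qed.

Lemma sym_ker_le e y : `|sym_ker e y| <= 8 * M.
Proof.
rewrite sym_kerE (le_trans (ler_normB _ _))//.
have := conj_ker_le pG M0 GM (x + e) (e - y).
have := conj_ker_le pG M0 GM (x - e) (y - e); lra.
Qed.

Lemma measurable_sym_ker e : measurable_fun setT (sym_ker e).
Proof.
apply: measurable_funM; first by apply: measurable_funB => //; exact: measurable_E.
by apply: measurableT_comp; [exact: measurable_kap|exact: measurable_funB].
Qed.

(** Shifting one integral by e and the other by - e, and reflecting the first, brings [G] to the
    points x + y and x - y under the common factor kap (e - y); the subtracted constants combine
    into E e. *)
Lemma conj_fun_symB e : 0 <= e <= pi ->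
  conj_fun G (x + e) - conj_fun G (x - e) =
  \int[mu]_(y in `[0, pi]) (sym_ker e y + sym_ker e (- y)).
Proof.
move=> /andP[e0 epi]; have int (C a b : R) (g : R -> R) : measurable_fun setT g -> (forall y, `|g y| <= C) ->
    mu.-integrable `[a, b] (EFin \o g).
  by move=> mg gC; apply: (@bounded_integrable_itv _ _ _ _ C) => //; exact: measurable_funTS.
have mck z (s : R) : measurable_fun setT (fun t : R => conj_ker G z (t + s)).
  by apply: measurableT_comp; [exact: (measurable_conj_ker M0 GM)|exact: measurable_funD].
have mck' z (s : R) : measurable_fun setT (fun t : R => conj_ker G z (s - t)).
  by apply: measurableT_comp; [exact: (measurable_conj_ker M0 GM)|exact: measurable_funB].
have ckle z t := conj_ker_le pG M0 GM z t.
rewrite (@conj_fun_shift (x + e) e) ?ger0_norm// (@conj_fun_shift (x - e) (- e)) ?normrN ?ger0_norm//.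
rewrite Rintegral_reflection// opprK.
under eq_Rintegral => y _ do rewrite [- y + e]addrC.
rewrite -RintegralB//; [|exact: (int (4 * M))..].
under eq_Rintegral do rewrite -sym_kerE.
have intk := int _ _ _ _ (measurable_sym_ker e) (sym_ker_le e).
rewrite (@Rintegral_itv_split _ _ _ _ 0); [|by rewrite oppr_le0 (ltW pi0)|exact: intk].
rewrite Rintegral_reflection ?opprK ?oppr0; last exact: measurable_sym_ker.
have intkN : mu.-integrable `[0, pi] (EFin \o (fun y => sym_ker e (- y))).
  apply: (int (8 * M)) => [|y]; last exact: sym_ker_le.
  by apply: measurableT_comp => //; exact: measurable_sym_ker.
by rewrite [LHS]addrC -RintegralD//; exact: intk.
Qed.

(** E is even, so folding y and - y leaves the factor kap (e + y) - kap (y - e) = 2 sin e / (cos y -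
    cos e). *)
Lemma sym_ker_sum e y : sin ((e - y) / 2) != 0 -> sin ((e + y) / 2) != 0 ->
  sym_ker e y + sym_ker e (- y) = 2 * sin e * ((E y - E e) / (cos y - cos e)).
Proof.
move=> s1 s2; have s1' : sin ((y - e) / 2) != 0.
  by rewrite -(opprB e y) mulNr sinN oppr_eq0.
have -> : sym_ker e y + sym_ker e (- y) = (E y - E e) * (kap (e + y) - kap (y - e)).
  rewrite /sym_ker opprK -(opprB e y) kapN /E !opprK; ring.
rewrite kapB_prod// cosB_prod (_ : y - e - (e + y) = - (2 * e)); last by ring.
rewrite [- (2 * e) / 2]mulNr [2 * e / 2]mulrAC divff ?pnatr_eq0// mul1r sinN.
have -> : sin ((y - e) / 2) = - sin ((e - y) / 2) by rewrite -(opprB e y) mulNr sinN.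
by field; rewrite s1 s2.
Qed.

Lemma sym_diffB_le y z : `|E y - E z| <= 2 * M * `|y - z|.
Proof.
rewrite (_ : E y - E z = (G (x + y) - G (x + z)) + (G (x - y) - G (x - z))); last first.
  by rewrite /E; ring.
rewrite (le_trans (ler_normD _ _))//.
have := GM (x + y) (x + z); have := GM (x - y) (x - z).
rewrite (_ : x - y - (x - z) = - (y - z)) ?normrN; last by ring.
rewrite (_ : x + y - (x + z) = y - z); last by ring.
lra.
Qed.

Lemma sym_diff_le y : `|E y| <= 2 * M * `|y|.
Proof.
have E0 : E 0 = 0 by rewrite /E addr0 subr0; ring.
by have := sym_diffB_le y 0; rewrite E0 !subr0.
Qed.

Definition diff_ker (e y : R) : R := (E y - E e) / (cos y - cos e).

Lemma measurable_diff_ker e : measurable_fun setT (diff_ker e).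
Proof.
apply: measurable_funM; first by apply: measurable_funB => //; exact: measurable_E.
apply: measurable_funV; apply: measurable_funB => //.
apply: continuous_measurable_fun; exact: continuous_cos.
Qed.

Lemma cosB_ge (e y : R) : 0 < e -> 0 <= y -> e + y <= pi ->
  e * `|y - e| / 8 <= `|cos y - cos e|.
Proof.
move=> e0 y0 eypi; rewrite cosB_prod !normrM ger0_norm// distrC.
have h1 : `|e + y| / 4 <= `|sin ((e + y) / 2)|.
  by apply: norm_sin_half_ge; rewrite ger0_norm// addr_ge0// ltW.
have h2 : `|e - y| / 4 <= `|sin ((e - y) / 2)|.
  by apply: norm_sin_half_ge; rewrite ler_norml; apply/andP; split; lra.
have h3 : e / 4 * (`|e - y| / 4) <= `|sin ((e + y) / 2)| * `|sin ((e - y) / 2)|.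
  apply: ler_pM => //; rewrite ?divr_ge0 ?(ltW e0)//.
  by apply: le_trans h1; rewrite ger0_norm; lra.
by move: h3; set A := `|_|; set B := _ * `|sin _|; lra.
Qed.

Lemma diff_ker_le (e y c : R) : 0 < e -> 0 <= y -> e + y <= pi -> 0 <= c ->
  `|E y - E e| <= c * `|y - e| -> `|diff_ker e y| <= 8 * c / e.
Proof.
move=> e0 y0 ey c0 Ec; have [->|ye] := eqVneq y e.
  by rewrite /diff_ker !subrr mul0r normr0 divr_ge0 ?mulr_ge0 ?(ltW e0).
have d0 : 0 < `|y - e| by rewrite normr_gt0 subr_eq0.
have := cosB_ge e0 y0 ey; rewrite /diff_ker normrM normfV; set D := `|cos _ - _| => De.
have D0 : 0 < D by apply: lt_le_trans De; rewrite divr_gt0// mulr_gt0.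
rewrite ler_pdivrMr// mulrAC ler_pdivlMr//.
apply: (le_trans (ler_wpM2r (ltW e0) Ec)).
have : c * (e * `|y - e| / 8) <= c * D by rewrite ler_wpM2l.
lra.
Qed.

(* The kernel is at most of order 1 / e, and of order eta^2 / |y - e|, which is
   eta / e outside an interval of length 2 eta e. *)
Lemma diff_ker_near_le (eta e : R) : 0 < eta <= 1 -> 0 < e -> 3 * e <= pi ->
  (forall y, 0 <= y <= 2 * e -> `|E y| <= eta ^+ 2 * y) ->
  `|\int[mu]_(y in `[0, 2 * e]) diff_ker e y| <= (48 + 32 * M) * eta.
Proof.
move=> /andP[eta0 eta1] e0 epi Ey.
have mq (a b : R) : measurable_fun `[a, b] (diff_ker e).
  by apply: measurable_funTS; exact: measurable_diff_ker.
have ee : eta * e <= e by rewrite ler_piMl// ltW.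
have ee0 : 0 < eta * e by rewrite mulr_gt0.
have q1 y : 0 <= y <= 2 * e -> `|diff_ker e y| <= 8 * (2 * M) / e.
  move=> /andP[y0 y2]; apply: diff_ker_le => //; [lra|by rewrite mulr_ge0|].
  exact: sym_diffB_le.
(* Here |E y| + |E e| <= 3 eta^2 e <= 3 eta |y - e|, a better slope than the Lipschitz constant 2 M
   of E. *)
have q2 y : 0 <= y <= 2 * e -> eta * e <= `|y - e| -> `|diff_ker e y| <= 8 * (3 * eta) / e.
  move=> yb; case/andP: (yb) => y0 y2 hy; apply: diff_ker_le => //; [lra|by rewrite mulr_ge0// ltW|].
  rewrite (le_trans (ler_normB _ _))//.
  have h1 := Ey _ yb.
  have h2 : `|E e| <= eta ^+ 2 * e by apply: Ey; apply/andP; split; lra.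
  have h3 : eta ^+ 2 * y <= eta ^+ 2 * (2 * e) by rewrite ler_wpM2l ?sqr_ge0.
  have h4 : 3 * eta * (eta * e) <= 3 * eta * `|y - e| by rewrite ler_wpM2l ?mulr_ge0 ?(ltW eta0).
  rewrite expr2 in h1 h2 h3; lra.
have int (a b : R) : 0 <= a -> b <= 2 * e -> mu.-integrable `[a, b] (EFin \o diff_ker e).
  move=> a0 b2; apply: (bounded_integrable_itv (C := 8 * (2 * M) / e)) => // y /andP[ya yb].
  by apply: q1; rewrite (le_trans a0)//= (le_trans yb).
rewrite (@Rintegral_itv_split _ _ _ _ (e - eta * e)); [|by apply/andP; split; lra|by apply: int].
rewrite (@Rintegral_itv_split _ _ (e - eta * e) _ (e + eta * e)); first last.
- by apply: int => //; lra.
- by apply/andP; split; lra.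
have b1 : `|\int[mu]_(y in `[0, e - eta * e]) diff_ker e y| <= 8 * (3 * eta) / e * (e - eta * e - 0).
  apply: normr_Rintegral_itv_le => //; first lra.
  move=> y /andP[y0 y2]; apply: q2; first by apply/andP; split; lra.
  by rewrite ler_normr; apply/orP; right; lra.
have b2 : `|\int[mu]_(y in `[e + eta * e, 2 * e]) diff_ker e y| <=
    8 * (3 * eta) / e * (2 * e - (e + eta * e)).
  apply: normr_Rintegral_itv_le => //; first lra.
  move=> y /andP[y0 y2]; apply: q2; first by apply/andP; split; lra.
  by rewrite ler_normr; apply/orP; left; lra.
have b3 : `|\int[mu]_(y in `[e - eta * e, e + eta * e]) diff_ker e y| <=
    8 * (2 * M) / e * (e + eta * e - (e - eta * e)).
  apply: normr_Rintegral_itv_le => //; first lra.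
  by move=> y /andP[y0 y2]; apply: q1; apply/andP; split; lra.
have c1 : 8 * (3 * eta) / e * (e - eta * e - 0) = 24 * eta * (1 - eta) by field; rewrite gt_eqF.
have c2 : 8 * (3 * eta) / e * (2 * e - (e + eta * e)) = 24 * eta * (1 - eta).
  by field; rewrite gt_eqF.
have c3 : 8 * (2 * M) / e * (e + eta * e - (e - eta * e)) = 32 * M * eta by field; rewrite gt_eqF.
rewrite c1 in b1; rewrite c2 in b2; rewrite c3 in b3.
have c4 : 0 <= eta * eta by rewrite mulr_ge0 ?ltW.
apply: (le_trans (ler_normD _ _)).
apply: (le_trans (lerD b1 (ler_normD _ _))).
lra.
Qed.

(** With u = 1 - cos y and v = 1 - cos e the left side is (E e u - E y v) / ((u - v) u), where v <=
    u / 2, v <= e^2 / 2 and u >= y^2 / 8. *)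
Lemma diff_ker_far_point (eta K e y : R) : 0 <= eta -> 0 <= K -> 0 < e -> 2 * e <= y <= pi ->
  (forall y, 0 <= y <= pi -> `|E y| <= eta * y + K * y ^+ 2) ->
  `|diff_ker e y + E y / (1 - cos y)| <= (48 * eta * e + 80 * K * e ^+ 2) * y ^- 2.
Proof.
move=> eta0 K0 e0 /andP[y2 ypi] EK.
have y0 : 0 < y by lra.
have h1 : y ^+ 2 / 8 <= 1 - cos y by apply: oneBcos_ge; rewrite ger0_norm// ltW.
have h2 : 1 - cos e <= e ^+ 2 / 2 := oneBcos_le e.
have h3 : 0 <= 1 - cos e by rewrite subr_ge0 cos_le1.
(* 1 - cos y >= 1 - cos (2 e) = 2 (1 - cos e) (1 + cos e), and cos e >= 0. *)
have h4 : 1 - cos e <= (1 - cos y) / 2.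
  have cy : cos y <= cos (2 * e).
    by rewrite leNgt ltr_cos -?leNgt ?in_itv/=//; apply/andP; split; lra.
  have ce : 0 <= cos e by apply: cos_ge0_pihalf; apply/andP; split; lra.
  have := cos_mulr2n e; rewrite -[e *+ 2]mulr_natl => c2; rewrite c2 in cy.
  have := cos_le1 e; move: cy ce; rewrite -[cos e ^+ 2 *+ 2]mulr_natl => cy ce c1.
  have : 0 <= cos e * (1 - cos e) by rewrite mulr_ge0.
  rewrite expr2 in cy; lra.
have E1 := EK _ (_ : 0 <= y <= pi); have {E1} : `|E y| <= eta * y + K * y ^+ 2.
  by apply: E1; rewrite ypi ltW.
have : `|E e| <= eta * e + K * e ^+ 2 by apply: EK; apply/andP; split; lra.
rewrite /diff_ker; set A := E y; set B := E e.
rewrite (_ : cos y - cos e = (1 - cos e) - (1 - cos y)); last by ring.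
move: h1 h2 h3 h4; set u := 1 - cos y; set v := 1 - cos e => h1 h2 h3 h4 hB hA.
have yy0 : 0 < y ^+ 2 by rewrite exprn_gt0.
have u0 : 0 < u by apply: lt_le_trans h1; rewrite divr_gt0.
have uv : u / 2 <= u - v by lra.
have uv0 : 0 < u - v by apply: lt_le_trans uv; rewrite divr_gt0.
have -> : (A - B) / (v - u) + A / u = (B * u - A * v) / ((u - v) * u).
  by rewrite -(opprB u v) invrN; field; rewrite (gt_eqF u0) (gt_eqF uv0).
have iu : u^-1 <= 8 / y ^+ 2.
  by rewrite -[X in _ <= X]invrK lef_pV2 ?posrE ?invr_gt0 ?divr_gt0// invf_div.
rewrite normrM normfV (ger0_norm (ltW (mulr_gt0 uv0 u0))).
apply: (@le_trans _ _ ((`|B| * u + `|A| * v) * (2 * u^-1 * u^-1))).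
  apply: ler_pM => //.
  - by rewrite invr_ge0 mulr_ge0// ltW.
  - by rewrite (le_trans (ler_normB _ _))// !normrM (gtr0_norm u0) (ger0_norm h3).
  rewrite invfM ler_wpM2r ?invr_ge0 ?(ltW u0)//.
  rewrite -[X in _ <= X]invrK lef_pV2 ?posrE ?invr_gt0 ?mulr_gt0 ?invr_gt0//.
  by rewrite invfM invrK mulrC.
have -> : (`|B| * u + `|A| * v) * (2 * u^-1 * u^-1) = 2 * `|B| * u^-1 + 2 * `|A| * v * (u^-1 * u^-1).
  by field; rewrite gt_eqF.
apply: (@le_trans _ _ (2 * (eta * e + K * e ^+ 2) * (8 / y ^+ 2) +
    2 * (eta * y + K * y ^+ 2) * (e ^+ 2 / 2) * (8 / y ^+ 2 * (8 / y ^+ 2)))).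
  apply: lerD.
    by apply: ler_pM; rewrite ?mulr_ge0 ?invr_ge0 ?(ltW u0)// ler_wpM2l.
  apply: ler_pM; rewrite ?mulr_ge0 ?invr_ge0 ?(ltW u0)//.
    by apply: ler_pM; rewrite ?mulr_ge0// ler_wpM2l.
  by apply: ler_pM; rewrite ?invr_ge0 ?(ltW u0).
have -> : 2 * (eta * e + K * e ^+ 2) * (8 / y ^+ 2) +
    2 * (eta * y + K * y ^+ 2) * (e ^+ 2 / 2) * (8 / y ^+ 2 * (8 / y ^+ 2)) =
  (16 * eta * e + 80 * K * e ^+ 2 + 64 * (eta * e) * (e / y)) * y ^- 2.
  by field; rewrite gt_eqF.
rewrite ler_wpM2r ?invr_ge0 ?sqr_ge0//.
have : (eta * e) * (e / y) <= (eta * e) * 2^-1.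
  rewrite ler_wpM2l ?mulr_ge0 ?(ltW e0)// ler_pdivrMr//; lra.
lra.
Qed.

Lemma measurable_sym_quot : measurable_fun setT (fun y => E y / (1 - cos y)).
Proof.
apply: measurable_funM; first exact: measurable_E.
apply: measurable_funV; apply: measurable_funB => //.
by apply: continuous_measurable_fun; exact: continuous_cos.
Qed.

(** The integral of y^-2 beyond 2 e is at most 1 / (2 e), which halves the constants and takes off
    one power of e. *)
Lemma diff_ker_far_le (eta K e : R) : 0 <= eta -> 0 <= K -> 0 < e -> 2 * e <= pi ->
  (forall y, 0 <= y <= pi -> `|E y| <= eta * y + K * y ^+ 2) ->
  `|\int[mu]_(y in `[2 * e, pi]) (diff_ker e y + E y / (1 - cos y))| <= 24 * eta + 40 * K * e.
Proof.
move=> eta0 K0 e0 epi EK; pose c := 48 * eta * e + 80 * K * e ^+ 2.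
have c0 : 0 <= c by rewrite addr_ge0 ?mulr_ge0 ?sqr_ge0 ?(ltW e0).
have pt y : 2 * e <= y <= pi -> `|diff_ker e y + E y / (1 - cos y)| <= c * (y - 0) ^- 2.
  by rewrite subr0 => yb; exact: diff_ker_far_point.
have vb (y : R) : 2 * e <= y <= pi -> `|(y - 0) ^- 2| <= (2 * e) ^- 2.
  move=> /andP[y2 _]; have y0 : 0 < y by lra.
  rewrite subr0 normfV ger0_norm ?sqr_ge0// lef_pV2 ?posrE ?exprn_gt0// ?mulr_gt0//.
  by rewrite lerXn2r ?nnegrE ?mulr_ge0 ?(ltW e0) ?(ltW y0).
have mv : measurable_fun setT (fun y : R => (y - 0) ^- 2).
  by apply: measurable_funV; apply: measurable_funX; apply: measurable_funB.
have iv : mu.-integrable `[2 * e, pi] (EFin \o (fun y : R => (y - 0) ^- 2)).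
  by apply: bounded_integrable_itv vb; apply: measurable_funTS.
have icv := integrable_mulrl c (measurable_itv _) iv.
have mf : measurable_fun setT (fun y => diff_ker e y + E y / (1 - cos y)).
  by apply: measurable_funD; [exact: measurable_diff_ker|exact: measurable_sym_quot].
have intf : mu.-integrable `[2 * e, pi] (EFin \o (fun y => diff_ker e y + E y / (1 - cos y))).
  apply: (bounded_integrable_itv (C := c * (2 * e) ^- 2)); first exact: measurable_funTS.
  move=> y yb; rewrite (le_trans (pt _ yb))// ler_wpM2l// (le_trans _ (vb _ yb))//.
  exact: ler_norm.
apply: (le_trans (le_normr_Rintegral _ _)) => //.
apply: (@le_trans _ _ (\int[mu]_(y in `[2 * e, pi]) (c * (y - 0) ^- 2))).
  have intn := integrable_norm intf.
  by apply: le_Rintegral => // y; rewrite /= in_itv/=; exact: pt.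
have dv y : 2 * e <= y <= pi -> is_derive y 1 (fun z : R => - (z - 0)^-1) ((y - 0) ^- 2).
  by move=> /andP[y2 _]; apply: is_derive_invB; rewrite gt_eqF//; lra.
have cv y : 2 * e <= y <= pi -> {for y, continuous (fun z : R => (z - 0) ^- 2)}.
  by move=> /andP[y2 _]; apply: continuous_invsqB; rewrite gt_eqF//; lra.
rewrite RintegralZl// (Rintegral_derivative epi dv cv) !subr0 opprK addrC.
apply: (@le_trans _ _ (c * (2 * e)^-1)).
  by rewrite ler_wpM2l// lerBlDr lerDl invr_ge0 ltW.
by rewrite le_eqVlt; apply/orP; left; apply/eqP; rewrite /c; field; rewrite gt_eqF.
Qed.

Lemma conj_fun_sym_diff e : 0 < e < pi ->
  mu.-integrable `[0, pi] (EFin \o diff_ker e) /\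
  (conj_fun G (x + e) - conj_fun G (x - e)) / (2 * sin e) =
  \int[mu]_(y in `[0, pi]) diff_ker e y.
Proof.
move=> /andP[e0 epi]; have sine : 0 < sin e by apply: sin_gt0_pi; rewrite e0.
have E2 y : 0 <= y <= pi -> sym_ker e y + sym_ker e (- y) = 2 * sin e * diff_ker e y.
  (* At y = e both sides are 0, since the numerators E y - E e vanish there. *)
  move=> /andP[y0 ypi]; have [->|ye] := eqVneq y e.
    rewrite /sym_ker /diff_ker (_ : E (- e) = E e) ?subrr ?mul0r ?mulr0 ?addr0//.
    by rewrite /E opprK; ring.
  apply: sym_ker_sum.
    move: ye; rewrite neq_lt => /orP[ye|ye].
      by rewrite gt_eqF// sin_gt0_pi//; apply/andP; split; lra.
    rewrite -(opprB y e) mulNr sinN oppr_eq0 gt_eqF// sin_gt0_pi//; apply/andP; split; lra.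
  by rewrite gt_eqF// sin_gt0_pi//; apply/andP; split; lra.
have int : mu.-integrable `[0, pi] (EFin \o diff_ker e); last first.
  split=> //; rewrite conj_fun_symB ?(ltW e0) ?(ltW epi)//.
  have -> : \int[mu]_(y in `[0, pi]) (sym_ker e y + sym_ker e (- y)) =
      \int[mu]_(y in `[0, pi]) (2 * sin e * diff_ker e y).
    by apply: eq_Rintegral => y; rewrite inE/= in_itv/=; exact: E2.
  by rewrite RintegralZl// mulrAC divff ?mul1r// gt_eqF// mulr_gt0.
apply: (bounded_integrable_itv (C := 16 * M / (2 * sin e))).
  by apply: measurable_funTS; exact: measurable_diff_ker.
move=> y yb; rewrite ler_pdivlMr ?mulr_gt0// mulrC.
have -> : 2 * sin e * `|diff_ker e y| = `|2 * sin e * diff_ker e y|.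
  by rewrite [RHS]normrM ger0_norm// mulr_ge0// ltW.
rewrite -E2// (le_trans (ler_normD _ _))//.
have := sym_ker_le e y; have := sym_ker_le e (- y); lra.
Qed.

Lemma sym_diff_quot_integrable e : 0 < e ->
  mu.-integrable `[e, pi] (EFin \o (fun y => E y / (1 - cos y))).
Proof.
move=> e0; apply: (bounded_integrable_itv (C := 2 * M * pi * (8 / e ^+ 2))).
  by apply: measurable_funTS; exact: measurable_sym_quot.
move=> y /andP[ey ypi]; have y0 : 0 < y by exact: lt_le_trans ey.
rewrite normrM; apply: ler_pM => //.
  by rewrite (le_trans (sym_diff_le y))// ler_wpM2l ?mulr_ge0// ger0_norm// ltW.
have h1 : y ^+ 2 / 8 <= 1 - cos y by apply: oneBcos_ge; rewrite ger0_norm// ltW.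
have h2 : e ^+ 2 <= y ^+ 2 by rewrite lerXn2r ?nnegrE ?(ltW e0) ?(ltW y0).
have ee : 0 < e ^+ 2 by rewrite exprn_gt0.
have h3 : e ^+ 2 / 8 <= 1 - cos y by lra.
have u0 : 0 < 1 - cos y by apply: lt_le_trans h3; rewrite divr_gt0.
rewrite normfV gtr0_norm// -[X in _ <= X]invrK lef_pV2 ?posrE ?invr_gt0 ?divr_gt0//.
by rewrite invf_div.
Qed.

Lemma sym_diff_little (eta : R) : 0 < eta -> derivable G x 1 -> exists2 r, 0 < r &
  forall y, 0 <= y <= r -> `|E y| <= eta * y.
Proof.
move=> eta0 /derivable_cvg_sym2 /cvgrPdist_le /(_ _ eta0)[r /= r0 rP].
exists (r / 2); first by rewrite divr_gt0.
move=> y /andP[]; rewrite le_eqVlt => /predU1P[<- _|y0 yr].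
  by rewrite (le_trans (sym_diff_le _))// normr0 !mulr0.
have := rP y; rewrite /= !sub0r !normrN (gtr0_norm y0) => /(_ _ y0).
rewrite normrM normfV (gtr0_norm y0) ler_pdivrMr//; apply; lra.
Qed.

Lemma conj_fun_sym_diff_le (eta r e : R) : 0 < eta <= 1 -> 0 < r -> 0 < e -> 2 * e <= r ->
  3 * e <= pi -> (forall y, 0 <= y <= r -> `|E y| <= eta ^+ 2 * y) ->
  `|(conj_fun G (x + e) - conj_fun G (x - e)) / (2 * sin e) +
    \int[mu]_(y in `[2 * e, pi]) (E y / (1 - cos y))| <=
  (72 + 32 * M) * eta + 80 * M / r * e.
Proof.
move=> eta01 r0 e0 er epi Er; case/andP: (eta01) => eta0 eta1.
have [|int ->] := @conj_fun_sym_diff e; first by rewrite e0/=; lra.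
have e2 : 0 <= 2 * e by rewrite mulr_ge0// ltW.
rewrite (@Rintegral_itv_split _ _ _ _ (2 * e))//; last by rewrite e2/=; lra.
have int2 := integrable_itvS e2 (lexx pi) int.
have intE : mu.-integrable `[2 * e, pi] (EFin \o (fun y => E y / (1 - cos y))).
  by apply: sym_diff_quot_integrable; rewrite mulr_gt0.
rewrite -addrA -RintegralD// (le_trans (ler_normD _ _))//.
have h1 : `|\int[mu]_(y in `[0, 2 * e]) diff_ker e y| <= (48 + 32 * M) * eta.
  apply: diff_ker_near_le => // y /andP[y0 y2]; apply: Er.
  by rewrite y0 (le_trans y2).
have h2 : `|\int[mu]_(y in `[2 * e, pi]) (diff_ker e y + E y / (1 - cos y))| <=
    24 * eta + 40 * (2 * M / r) * e.
  apply: diff_ker_far_le => //; [exact: ltW|by rewrite divr_ge0 ?mulr_ge0 ?(ltW r0)|lra|].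
  move=> y /andP[y0 ypi]; have y20 : 0 <= y ^+ 2 by rewrite sqr_ge0.
  have K0 : 0 <= 2 * M / r by rewrite divr_ge0 ?mulr_ge0 ?(ltW r0).
  have [yr|yr] := leP y r.
    have h : eta ^+ 2 * y <= eta * y by rewrite ler_wpM2r// expr2 ler_piMr// ltW.
    by rewrite (le_trans (Er _ _)) ?y0// (le_trans h)// lerDl mulr_ge0.
  (* Beyond r one has y <= y^2 / r, which turns the bound 2 M y into K y^2 with K = 2 M / r. *)
  rewrite (le_trans (sym_diff_le _))// (ger0_norm y0) ler_wpDl ?mulr_ge0 ?(ltW eta0)//.
  rewrite expr2 mulrA ler_wpM2r// mulrAC ler_pdivlMr//.
  by rewrite ler_wpM2l ?mulr_ge0// ltW.
have h3 : 40 * (2 * M / r) * e = 80 * M / r * e by ring.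
lra.
Qed.

Lemma sym_diff_cvg : derivable G x 1 -> derivable (conj_fun G) x 1 ->
  \int[mu]_(y in `[e, pi]) (E y / (1 - cos y)) @[e --> 0^'+] -->
  (- 'D_1 (conj_fun G) x : R).
Proof.
move=> dG dH; pose Q (e : R) := (conj_fun G (x + e) - conj_fun G (x - e)) / (2 * sin e).
pose F (e : R) := \int[mu]_(y in `[e, pi]) (E y / (1 - cos y)).
have sin1 : sin e / e @[e --> 0^'+] --> (1 : R).
  have ds : is_derive (0 : R) 1 sin (cos 0) := is_derive_sin 0.
  have := @derivable_cvg_right _ _ _ (@ex_derive _ _ _ _ _ _ _ ds).
  rewrite derive_val cos0; apply: cvg_trans; apply: near_eq_cvg; near=> e.
  by rewrite add0r sin0 subr0.
have Qcvg : Q e @[e --> 0^'+] --> ('D_1 (conj_fun G) x : R).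
  have h : ((conj_fun G (x + e) - conj_fun G (x - e)) / e) * (2 * (sin e / e))^-1
      @[e --> 0^'+] --> 2 * 'D_1 (conj_fun G) x * (2 * 1)^-1.
    apply: cvgM; first exact: derivable_cvg_sym.
    by apply: cvgV; [rewrite mulr1|apply: cvgM => //; exact: cvg_cst].
  have hD : 2 * 'D_1 (conj_fun G) x * (2 * 1)^-1 = 'D_1 (conj_fun G) x by field.
  rewrite -[X in _ --> X]hD; apply: cvg_trans h.
  apply: near_eq_cvg; near=> e.
  have e0 : 0 < e by near: e; exact: nbhs_right_gt.
  have epi : e < pi by near: e; exact: nbhs_right_lt.
  rewrite /Q; field; rewrite !gt_eqF// sin_gt0_pi//; exact/andP.
have QF : Q e + F (2 * e) @[e --> 0^'+] --> (0 : R).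
  (* First eta is chosen, for (72 + 32 M) eta; then r, from differentiability at precision eta^2;
     and e last, for the term 80 M e / r. *)
  apply/cvgrPdist_le => d d0; pose A := 72 + 32 * M + 1.
  have A0 : 0 < A by rewrite ltr_wpDl// addr_ge0// mulr_ge0.
  pose eta := Num.min 1 (d / (2 * A)).
  have eta0 : 0 < eta by rewrite lt_min ltr01 divr_gt0// mulr_gt0.
  have eta1 : eta <= 1 by rewrite ge_min lexx.
  have [r r0 rP] := sym_diff_little (exprn_gt0 2 eta0) dG.
  have B0 : 0 <= 80 * M / r by rewrite divr_ge0 ?mulr_ge0// ltW.
  near=> e; rewrite sub0r normrN.
  have e0 : 0 < e by near: e; exact: nbhs_right_gt.
  have e1 : e <= r / 2 by near: e; apply: nbhs_right_le; rewrite divr_gt0.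
  have e2 : e <= pi / 3 by near: e; apply: nbhs_right_le; rewrite divr_gt0.
  have e3 : e <= d / 2 / (80 * M / r + 1).
    by near: e; apply: nbhs_right_le; rewrite !divr_gt0// ltr_wpDl.
  rewrite (le_trans (conj_fun_sym_diff_le _ r0 e0 _ _ rP)) ?eta0//; [lra|lra|].
  have h1 : A * eta <= d / 2.
    have : eta <= d / (2 * A) by rewrite ge_min lexx orbT.
    by rewrite ler_pdivlMr ?mulr_gt0//; lra.
  rewrite ler_pdivlMr ?ltr_wpDl// in e3.
  rewrite /A in h1; lra.
have F2 : F (2 * e) @[e --> 0^'+] --> (- 'D_1 (conj_fun G) x : R).
  have := cvgB QF Qcvg; rewrite sub0r => h; apply: cvg_trans (h _).
  apply: near_eq_cvg; near=> e.
  by rewrite -[LHS]/(Q e + F (2 * e) - Q e) addrAC subrr add0r.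
apply/cvgrPdist_le => d d0.
have /cvgrPdist_le/(_ _ d0)[r /= r0 rP] := F2.
exists r => //= e /=; rewrite sub0r normrN => er e0.
have := rP (e / 2); rewrite /= sub0r normrN (_ : 2 * (e / 2) = e); last by field.
apply; last by rewrite divr_gt0.
by rewrite normrM; apply: le_lt_trans er; rewrite ler_piMr// ger0_norm; lra.
Unshelve. all: by end_near. Qed.

End conjugate_symmetric.

(** * Lipschitz points and extensions *)

(* McShane's extension G x = inf_(z in E) (f z + M |x - z|). *)
Lemma lipschitz_extension {R : realType} (E : set R) (f : R -> R) (T M : R) :
  0 <= M -> (forall x, E x -> E (x + T)) -> (forall x, E x -> E (x - T)) ->
  periodic f T -> (forall x y, E x -> E y -> `|f x - f y| <= M * `|x - y|) ->
  exists G : R -> R, [/\ periodic G T, forall x y, `|G x - G y| <= M * `|x - y| &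
    forall x, E x -> G x = f x].
Proof.
move=> M0 ET ENT pf fM; have [->|/set0P[z0 Ez0]] := eqVneq E set0.
  by exists (cst 0); split => // x y; rewrite subrr normr0 mulr_ge0.
pose S x : set R := [set f z + M * `|x - z| | z in E].
have S0 x : S x !=set0 by exists (f z0 + M * `|x - z0|), z0.
have Slb x : has_lbound (S x).
  exists (f z0 - M * `|x - z0|) => _ [z Ez <-].
  have : `|f z0 - f z| <= M * `|z0 - z| := fM _ _ Ez0 Ez.
  rewrite ler_norml => /andP[_ h].
  have h2 : M * `|z0 - z| <= M * (`|x - z0| + `|x - z|).
    rewrite ler_wpM2l// (_ : z0 - z = (x - z) - (x - z0)); last by ring.
    by rewrite (le_trans (ler_normB _ _))// addrC.
  rewrite mulrDr in h2; lra.
have Gle x y : inf (S x) <= inf (S y) + M * `|x - y|.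
  rewrite -lerBlDr; apply: lb_le_inf => // _ [z Ez <-]; rewrite lerBlDr.
  apply: (@le_trans _ _ (f z + M * `|x - z|)); first by apply: ge_inf => //; exists z.
  rewrite -addrA lerD2l -mulrDr ler_wpM2l// (_ : x - z = (y - z) + (x - y)); last by ring.
  exact: ler_normD.
exists (fun x => inf (S x)); split.
- move=> x; congr inf; apply/seteqP; split => _ [z Ez <-].
    exists (z - T); first exact: ENT.
    by rewrite -[f (z - T)]pf subrK; congr (_ + _ * `|_|); ring.
  exists (z + T); first exact: ET.
  by rewrite pf; congr (_ + _ * `|_|); ring.
- move=> x y; rewrite ler_norml; apply/andP; split.
    by have := Gle y x; rewrite distrC; lra.
  by have := Gle x y; lra.
- move=> x Ex; apply/eqP; rewrite eq_le; apply/andP; split.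
    by apply: ge_inf => //; exists x => //; rewrite subrr normr0 mulr0 addr0.
  apply: lb_le_inf => // _ [z Ez <-].
  have := fM _ _ Ex Ez; rewrite ler_norml => /andP[_]; lra.
Qed.

Section lipschitz_points.
Context {R : realType}.
Notation mu := (@lebesgue_measure R).
Variables (f : R -> R) (C T : R).
Hypotheses (pf : periodic f T) (fC : forall x, `|f x| <= C).

Definition lip_points (M : R) : set R :=
  [set x | forall y, `|f y - f x| <= M * `|y - x|].

Lemma lip_pointsS (M M' : R) : M <= M' -> lip_points M `<=` lip_points M'.
Proof.
by move=> MM x Mx y; rewrite (le_trans (Mx y))// ler_wpM2r.
Qed.

Lemma lip_pointsD M x : lip_points M x -> lip_points M (x + T).
Proof.
move=> Mx y; have := Mx (y - T); rewrite -[f (y - T)]pf subrK pf.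
by rewrite (_ : y - T - x = y - (x + T))//; ring.
Qed.

Lemma lip_pointsB M x : lip_points M x -> lip_points M (x - T).
Proof.
move=> Mx y; have := Mx (y + T); rewrite pf -[f (x - T)]pf subrK.
by rewrite (_ : y + T - x = y - (x - T))//; ring.
Qed.

(** No continuity of [f] is available, but a nearby point z of the set controls f x - f z too. The
    total error is 2 M |x - z|. *)
Lemma closed_lip_points M : 0 <= M -> closed (lip_points M).
Proof.
move=> M0 x clx y; apply/ler_addgt0Pr => e e0.
have d0 : 0 < e / (2 * M + 1) by rewrite divr_gt0// ltr_wpDl// mulr_ge0.
have [z [Mz /=]] := clx _ (nbhsx_ballx x _ d0).
rewrite /ball/= ltr_pdivlMr ?ltr_wpDl ?mulr_ge0// => xz.
have h1 := Mz y; have h2 := Mz x.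
have h3 : M * `|y - z| <= M * (`|y - x| + `|x - z|).
  by rewrite ler_wpM2l// (_ : y - z = (y - x) + (x - z)) ?ler_normD//; ring.
have h4 : `|f y - f x| <= `|f y - f z| + `|f x - f z|.
  by rewrite (_ : f y - f x = (f y - f z) - (f x - f z)) ?ler_normB//; ring.
have := normr_ge0 (x - z); rewrite mulrDr in h3; lra.
Qed.

Lemma measurable_lip_points M : 0 <= M -> measurable (lip_points M : set (measurableTypeR R)).
Proof. by move=> M0; apply: closed_measurable; exact: closed_lip_points. Qed.

Lemma derivable_lip_points (x : R) : derivable f x 1 -> exists n : nat, lip_points n%:R x.
Proof.
move=> df; have : h^-1 *: (f (h *: 1 + x) - f x) @[h --> 0^'] --> 'D_1 f x by exact: df.
move=> /cvgrPdist_le /(_ _ ltr01)[r /= r0 rP].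
have C0 : 0 <= C by rewrite (le_trans _ (fC 0)).
set D := 'D_1 f x in rP.
(* |D| + 1 serves for |y - x| < r; farther away the increment is at most 2 C <= (2 C / r) |y -
   x|. *)
exists (Num.truncn (`|D| + 1 + 2 * C / r)).+1 => y.
have K0 : 0 <= 2 * C / r by rewrite divr_ge0 ?mulr_ge0// ltW.
apply: (@le_trans _ _ ((`|D| + 1 + 2 * C / r) * `|y - x|)); last first.
  by rewrite ler_wpM2r// ltW// Num.Theory.truncnS_gt.
rewrite mulrDl; have [yr|yr] := ltP `|y - x| r.
  suff h : `|f y - f x| <= (`|D| + 1) * `|y - x| by rewrite (le_trans h)// lerDl mulr_ge0.
  have [->|yx] := eqVneq y x; first by rewrite !subrr normr0 mulr0.
  have := rP (y - x); rewrite /= sub0r normrN [_ *: 1]mulr1 subrK subr_eq0 => /(_ yr yx) h.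
  have d0 : 0 < `|y - x| by rewrite normr_gt0 subr_eq0.
  rewrite -ler_pdivrMr//.
  have -> : `|f y - f x| / `|y - x| = `|(y - x)^-1 *: (f y - f x)|.
    by rewrite [_ *: _]mulrC normrM normfV.
  set q := _ *: _ in h *.
  rewrite (_ : q = D - (D - q)); last by ring.
  by rewrite (le_trans (ler_normB _ _))// lerD2l.
suff h : `|f y - f x| <= 2 * C / r * `|y - x|.
  by rewrite (le_trans h)// lerDr mulr_ge0// addr_ge0.
apply: (@le_trans _ _ (2 * C)).
  by rewrite (le_trans (ler_normB _ _))//; have := fC y; have := fC x; lra.
by rewrite mulrAC ler_pdivlMr// ler_wpM2l ?mulr_ge0.
Qed.

Lemma lip_points_extension (n : nat) : exists G : R -> R,
  [/\ periodic G T, forall x y, `|G x - G y| <= n%:R * `|x - y| &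
    forall x, lip_points n%:R x -> G x = f x].
Proof.
apply: lipschitz_extension => //.
- exact: lip_pointsD.
- exact: lip_pointsB.
Qed.

(* Unlike f, it is measurable as soon as G is; away from the Lipschitz points,
   the value of G makes the difference with G vanish. *)
Definition lip_part (G : R -> R) (x : R) : R :=
  if asbool (exists n : nat, lip_points n%:R x) then f x else G x.

Lemma lip_partE G n x : lip_points n%:R x -> lip_part G x = f x.
Proof. by move=> nx; rewrite /lip_part asboolT//; exists n. Qed.

(** On the n-th set of Lipschitz points [f] agrees with a Lipschitz function [g n]. These closed
    sets increase, so gluing [g n] to [G] gives measurable functions eventually constant in n at
    each point. *)
Lemma measurable_lip_part G : measurable_fun setT G -> measurable_fun setT (lip_part G).
Proof.
move=> mG; have [g gP] := choice lip_points_extension.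
pose E n : set (measurableTypeR R) := lip_points n%:R.
have mE n : measurable (E n) by exact: measurable_lip_points.
have mg n : measurable_fun setT (g n).
  by have [_ gl _] := gP n; exact: (measurable_lip (ler0n _ n) gl).
apply: (@measurable_fun_cvg _ _ _ _
  (fun n x => \1_(E n) x * g n x + (1 - \1_(E n) x) * G x)) => [n|x _].
  apply: measurable_funD; apply: measurable_funM => //.
  - exact: mg.
  - by apply: measurable_funB => //; exact: measurable_indic.
apply: cvg_near_cst; rewrite /lip_part; case: asboolP => [[m mx]|nx].
  near=> n; have nx : lip_points n%:R x.
    by apply: lip_pointsS mx; rewrite ler_nat; near: n; exact: nbhs_infty_ge.
  have [_ _ ->//] := gP n.
  by rewrite indicE mem_set// subrr mul0r addr0 mul1r.
by near=> n; rewrite indicE memNset ?mul0r ?add0r ?subr0 ?mul1r// => nx'; apply: nx; exists n.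
Unshelve. all: by end_near. Qed.

(** The Lipschitz points exhaust almost all of [a, b], so for some n they miss a set of measure less
    than eta; on them the Lipschitz bound at x is itself the modulus. *)
Lemma ae_modulus_lip_part G a b : {ae mu, forall x, exists n : nat, lip_points n%:R x} ->
  ae_modulus f (lip_part G) a b.
Proof.
move=> aef eta eta0.
pose F n : set (measurableTypeR R) := `[a, b]%classic `&` ~` lip_points n%:R.
have mE n : measurable (lip_points n%:R : set (measurableTypeR R)) by exact: measurable_lip_points.
have mF n : measurable (F n) by apply: measurableI => //; exact: measurableC.
have mcap : measurable (\bigcap_n F n) by exact: bigcapT_measurable.
have F0 : (mu (F 0%N) < +oo)%E.
  apply: (@le_lt_trans _ _ (mu `[a, b])).
    by apply: le_measure; [by rewrite inE; exact: mF|by rewrite inE|exact: subIsetl].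
  by rewrite /= lebesgue_measure_itv/=; case: ifPn => _; rewrite ?ltry// -EFinB ltry.
have dF : nonincreasing_seq F.
  apply/nonincreasing_seqP => n; apply/subsetPset; apply: setIS; apply: subsetC.
  by apply: lip_pointsS; rewrite ler_nat.
have cap0 : mu (\bigcap_n F n) = 0%E.
  apply/measure_negligible => //; apply: negligibleS aef => x capx /= -[n nx].
  by have [_] := capx n I.
have : mu \o F @ \oo --> 0%E by rewrite -cap0; exact: nonincreasing_cvg_mu.
move=> /fine_cvgP[Ffin].
move=> /cvgrPdist_lt/(_ _ eta0) Fe.
near \oo => n; exists (lip_points n%:R), (eta / n.+1%:R); split.
- exact: mE.
- by rewrite divr_gt0.
- have : mu (F n) \is a fin_num by near: n.
  have : `|0 - fine (mu (F n))| < eta by near: n.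
  rewrite sub0r normrN ger0_norm ?fine_ge0// => h /fineK <-.
  by rewrite lee_fin ltW.
- move=> x y nx _ _ yx; rewrite (lip_partE _ nx) (le_trans (nx y))//.
  rewrite ltr_pdivlMr// in yx; apply: le_trans (ltW yx).
  by rewrite mulrC ler_wpM2l// ler_nat.
Unshelve. all: by end_near. Qed.

End lipschitz_points.

(** * Truncated Hilbert-Stieltjes integrals *)

Section kernel.
Context {R : realType}.
Notation mu := (@lebesgue_measure R).
Implicit Types t tau : R.

Lemma is_derive_kap t : sin (t / 2) != 0 -> is_derive t 1 (@kap R) (- (1 - cos t)^-1).
Proof.
move=> s0.
have hh : is_derive t 1 (fun t : R => t / 2) 2^-1.
  have h := is_deriveM (is_derive_id t (1 : R)) (is_derive_cst (2^-1 : R) t (1 : R)).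
  by apply: (is_derive_eq h); rewrite scaler0 add0r [_ *: 1]mulr1.
have hc : is_derive t 1 (fun t : R => cos (t / 2)) (- sin (t / 2) * 2^-1).
  exact: (@is_derive1_comp R cos (fun t : R => t / 2) t _ _ (is_derive_cos _) hh).
have hs : is_derive t 1 (fun t : R => sin (t / 2)) (cos (t / 2) * 2^-1).
  exact: (@is_derive1_comp R sin (fun t : R => t / 2) t _ _ (is_derive_sin _) hh).
have hv := @is_deriveV _ _ _ _ _ s0 hs.
have h := is_deriveM hc hv.
apply: (is_derive_eq h); rewrite cosE_half.
rewrite -![_ *: _]/(_ * _) /=.
move: (cos2Dsin2 (t / 2)) s0; set s := sin _; set c := cos _ => cs s0.
have -> : c * (- s ^- 2 * (c / 2)) + s^-1 * (- s / 2) = - ((c ^+ 2 + s ^+ 2) / (2 * s ^+ 2)).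
  by field.
by rewrite cs mul1r.
Qed.

Lemma hs_kernel_kap tau t : hs_kernel tau t = kap (tau - t).
Proof. exact: hs_kernelE. Qed.

Lemma is_derive_hs_kernel tau t : sin ((tau - t) / 2) != 0 ->
  is_derive t 1 (hs_kernel tau) ((1 - cos (t - tau))^-1).
Proof.
move=> s0; have hB : is_derive t (1 : R) (fun x : R => tau - x) (-1).
  by apply: (is_derive_eq (is_deriveB _ _)); rewrite sub0r.
have h := @is_derive1_comp R kap (fun x : R => tau - x) t _ _ (is_derive_kap s0) hB.
rewrite (_ : hs_kernel tau = kap \o (fun x : R => tau - x)); last first.
  by apply/funext => x; rewrite hs_kernel_kap.
by apply: (is_derive_eq h); rewrite mulrN1 opprK -cosN opprB.
Qed.

Definition hs_weight tau t : R := (1 - cos (t - tau))^-1.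

Lemma measurable_hs_weight tau : measurable_fun setT (hs_weight tau).
Proof.
apply: measurable_funV; apply: measurable_funB => //.
apply: continuous_measurable_fun => x.
apply: (@continuous_comp _ _ _ (fun x : R => x - tau) cos); last exact: continuous_cos.
by apply: cvgB; [exact: cvg_id|exact: cvg_cst].
Qed.

Lemma hs_weight_le tau e t : 0 < e -> e <= `|t - tau| <= pi ->
  `|hs_weight tau t| <= 8 / e ^+ 2.
Proof.
move=> e0 /andP[et tpi]; have h1 := oneBcos_ge tpi.
have h2 : e ^+ 2 <= (t - tau) ^+ 2.
  by rewrite -[leRHS](real_normK (num_real _)) lerXn2r ?nnegrE ?(ltW e0).
have ee : 0 < e ^+ 2 by rewrite exprn_gt0.
have h3 : e ^+ 2 / 8 <= 1 - cos (t - tau) by lra.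
have u0 : 0 < 1 - cos (t - tau) by apply: lt_le_trans h3; rewrite divr_gt0.
rewrite /hs_weight normfV gtr0_norm// -[X in _ <= X]invrK.
by rewrite lef_pV2 ?posrE ?invr_gt0 ?divr_gt0// invf_div.
Qed.

Lemma continuous_hs_weight tau t : 0 < `|t - tau| <= pi ->
  {for t, continuous (hs_weight tau)}.
Proof.
move=> /andP[t0 tpi]; apply: (@continuousV _ _ (fun t => 1 - cos (t - tau))).
  rewrite gt_eqF// (lt_le_trans _ (oneBcos_ge tpi))// divr_gt0//.
  by rewrite -(real_normK (num_real _)) exprn_gt0.
apply: continuousB; first exact: cst_continuous.
apply: (@continuous_comp _ _ _ (fun x : R => x - tau) cos); last exact: continuous_cos.
by apply: cvgB; [exact: cvg_id|exact: cvg_cst].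
Qed.

Lemma hs_kernelB tau a b : a <= b ->
  (forall t, a <= t <= b -> 0 < `|t - tau| <= pi) ->
  hs_kernel tau b - hs_kernel tau a = \int[mu]_(t in `[a, b]) hs_weight tau t.
Proof.
move=> ab h.
have dk t : a <= t <= b -> is_derive t 1 (hs_kernel tau) (hs_weight tau t).
  move=> /h/andP[t0 tpi]; apply: is_derive_hs_kernel.
  rewrite distrC in t0 tpi; have h1 := norm_sin_half_ge tpi.
  by rewrite -normr_gt0 (lt_le_trans _ h1)// divr_gt0.
have cw t : a <= t <= b -> {for t, continuous (hs_weight tau)}.
  by move=> /h; exact: continuous_hs_weight.
by rewrite (Rintegral_derivative ab dk cw).
Qed.

Lemma hs_kernel_pi tau : hs_kernel tau (tau + pi) = 0 /\ hs_kernel tau (tau - pi) = 0.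
Proof.
rewrite !hs_kernelE opprD addrA subrr sub0r opprB addrCA subrr addr0.
by rewrite mulNr cosN cos_pihalf !mul0r.
Qed.

Lemma hs_kernel_tau tau e : hs_kernel tau (tau + e) = - kap e /\ hs_kernel tau (tau - e) = kap e.
Proof.
rewrite !hs_kernel_kap -kapN; split; congr kap; ring.
Qed.

Lemma kap_le (e : R) : 0 < e <= pi -> `|kap e| <= 4 / e.
Proof.
move=> /andP[e0 epi]; have := norm_sin_half_ge (_ : `|e| <= pi).
rewrite (gtr0_norm e0) => /(_ epi) h.
have s0 : 0 < `|sin (e / 2)| by apply: lt_le_trans h; rewrite divr_gt0.
rewrite /kap normrM normfV ler_pdivrMr// (le_trans (cos_max _))//.
by rewrite mulrAC ler_pdivlMr// mul1r; lra.
Qed.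

End kernel.

(** * Integration by parts in the truncated integrals *)

Section truncated.
Context {R : realType}.
Notation mu := (@lebesgue_measure R).
Variables (Phi phi : R -> R) (C tau : R).
Hypotheses (C0 : 0 <= C).
Hypotheses (PhiC : forall x, `|Phi x| <= C) (phiC : forall x, `|phi x| <= C).
Hypothesis mphi : measurable_fun setT phi.
Hypothesis mod : forall a b, ae_modulus Phi phi a b.

Let f (t : R) : R := (phi t - Phi tau) * hs_weight tau t.

(** Integration by parts with the constant [Phi tau] subtracted. It changes nothing, as the integral
    of the weight is the increment of the kernel, and it makes the density small near tau. *)
Lemma is_rs_integral_hs (a b e : R) : 0 < e -> a <= b ->
  (forall t, a <= t <= b -> e <= `|t - tau| <= pi) ->
  is_rs_integral (hs_kernel tau) Phi a b
    (hs_kernel tau b * (Phi b - Phi tau) - hs_kernel tau a * (Phi a - Phi tau) -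
     \int[mu]_(t in `[a, b]) f t).
Proof.
move=> e0 ab he; have W0 : 0 <= 8 / e ^+ 2 by rewrite divr_ge0 ?sqr_ge0.
have wW t : a <= t <= b -> `|hs_weight tau t| <= 8 / e ^+ 2.
  by move=> /he; exact: hs_weight_le.
have kw u v : a <= u -> u <= v -> v <= b ->
    hs_kernel tau v - hs_kernel tau u = \int[mu]_(t in `[u, v]) hs_weight tau t.
  move=> au uv vb; apply: hs_kernelB => // t /andP[ut tv].
  have /andP[et ->] : e <= `|t - tau| <= pi.
    by apply: he; rewrite (le_trans au)//= (le_trans tv).
  by rewrite (lt_le_trans e0).
have := is_rs_integral_by_parts ab C0 W0 PhiC phiC mphi (measurable_hs_weight tau) wW kw (mod a b).
congr is_rs_integral.
have mw := measurable_funTS (measurable_hs_weight tau) : measurable_fun `[a, b] _.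
have iw : mu.-integrable `[a, b] (EFin \o hs_weight tau) by exact: bounded_integrable_itv wW.
have ip : mu.-integrable `[a, b] (EFin \o (fun t => phi t * hs_weight tau t)).
  apply: (bounded_integrable_itv (C := C * (8 / e ^+ 2))).
    by apply: measurable_funTS; apply: measurable_funM => //; exact: measurable_hs_weight.
  by move=> t /wW h; rewrite normrM ler_pM.
rewrite /f; under [in RHS]eq_Rintegral do rewrite mulrBl.
rewrite RintegralB//; last exact: integrable_mulrl.
rewrite RintegralZl// -kw//; ring.
Qed.

(** The kernel vanishes at tau + pi and tau - pi, so only the boundary terms at tau + e and tau - e
    remain. *)
Lemma is_truncated_hs_parts e : 0 < e <= pi ->
  is_truncated_hs Phi tau e
    (kap e * (Phi (tau + e) + Phi (tau - e) - 2 * Phi tau) -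
     (\int[mu]_(t in `[tau + e, tau + pi]) f t + \int[mu]_(t in `[tau - pi, tau - e]) f t)).
Proof.
move=> /andP[e0 epi].
have r1 t : tau - pi <= t <= tau - e -> e <= `|t - tau| <= pi.
  by move=> /andP[h1 h2]; rewrite distrC ger0_norm; [apply/andP; split|]; lra.
have r2 t : tau + e <= t <= tau + pi -> e <= `|t - tau| <= pi.
  by move=> /andP[h1 h2]; rewrite ger0_norm; [apply/andP; split|]; lra.
have le1 : tau - pi <= tau - e by lra.
have le2 : tau + e <= tau + pi by lra.
have [k1 k2] := hs_kernel_pi tau; have [k3 k4] := hs_kernel_tau tau e.
do 2 eexists; split.
- exact: (is_rs_integral_hs e0 le1 r1).
- exact: (is_rs_integral_hs e0 le2 r2).
- rewrite k1 k2 k3 k4; ring.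
Qed.

Lemma hs_converges_of_weighted (L : R) : derivable Phi tau 1 ->
  \int[mu]_(t in `[tau + e, tau + pi]) f t + \int[mu]_(t in `[tau - pi, tau - e]) f t
    @[e --> 0^'+] --> L ->
  hilbert_stieltjes_converges Phi tau.
Proof.
move=> dPhi fL; exists ((2 * pi)^-1 * (- L)).
exists (fun e => kap e * (Phi (tau + e) + Phi (tau - e) - 2 * Phi tau) -
     (\int[mu]_(t in `[tau + e, tau + pi]) f t + \int[mu]_(t in `[tau - pi, tau - e]) f t)).
  by move=> e /andP[e0 epi]; apply: is_truncated_hs_parts; rewrite e0 ltW.
apply: cvgM; first exact: cvg_cst.
rewrite -[- L]add0r; apply: cvgB => //.
apply/cvgrPdist_le => d d0.
have d4 : 0 < d / 4 by rewrite divr_gt0.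
have /cvgrPdist_le/(_ _ d4) h := derivable_cvg_sym2 dPhi.
near=> e; rewrite sub0r normrN.
have e0 : 0 < e by near: e; exact: nbhs_right_gt.
have epi : e <= pi by near: e; apply: nbhs_right_le; exact: pi_gt0.
have : `|0 - (Phi (tau + e) + Phi (tau - e) - 2 * Phi tau) / e| <= d / 4 by near: e.
rewrite sub0r normrN normrM normfV (gtr0_norm e0) ler_pdivrMr// => hd.
(* |kap e| <= 4 / e, while the second symmetric difference is at most (d / 4) e. *)
rewrite normrM (_ : d = 4 / e * (d / 4 * e)); last by field; rewrite gt_eqF.
by apply: ler_pM => //; apply: kap_le; rewrite e0.
Unshelve. all: by end_near. Qed.

End truncated.

Section one_sided_limits.
Context {R : realType}.
Notation mu := (@lebesgue_measure R).

Lemma Rintegral_cvg_right (f : R -> R) (a l : R) : 0 < l ->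
  mu.-integrable `[a, a + l] (EFin \o f) ->
  \int[mu]_(t in `[a + e, a + l]) f t @[e --> 0^'+] --> \int[mu]_(t in `[a, a + l]) f t.
Proof.
move=> l0 intf; have al : a < a + l by rewrite ltrDl.
apply/cvgrPdist_lt => d d0.
have [r /= r0 rP] := parameterized_integral_near_left al d0 intf.
near=> e.
have e0 : 0 < e by near: e; exact: nbhs_right_gt.
have el : e <= l by near: e; exact: nbhs_right_le.
have er : e < r by near: e; exact: nbhs_right_lt.
rewrite (@Rintegral_itv_split _ _ _ _ (a + e))//; last first.
  by rewrite lerDl lerD2l (ltW e0).
rewrite addrK; apply: rP; last by rewrite lerDl ltW.
by rewrite /ball/= opprD addrA subrr sub0r normrN gtr0_norm.
Unshelve. all: by end_near. Qed.

Lemma Rintegral_cvg_left (f : R -> R) (a l : R) : 0 < l ->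
  mu.-integrable `[a - l, a] (EFin \o f) ->
  \int[mu]_(t in `[a - l, a - e]) f t @[e --> 0^'+] --> \int[mu]_(t in `[a - l, a]) f t.
Proof.
move=> l0 intf; have al : a - l < a by rewrite ltrBlDr ltrDl.
apply/cvgrPdist_lt => d d0.
have /cvgrPdist_lt/(_ _ d0) [r /= r0 rP] := parameterized_integral_cvg_at_left al intf.
near=> e.
have e0 : 0 < e by near: e; exact: nbhs_right_gt.
have er : e < r by near: e; exact: nbhs_right_lt.
apply: rP; last by rewrite ltrBlDr ltrDl.
by rewrite /= opprD addrA subrr sub0r opprK gtr0_norm.
Unshelve. all: by end_near. Qed.

End one_sided_limits.

(** * Convergence at a point, and almost everywhere *)

Section convergence.
Context {R : realType}.
Notation mu := (@lebesgue_measure R).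

Let pi0 : 0 < pi :> R := pi_gt0 R.

Lemma weighted_symmetric (G : R -> R) (M tau e : R) : 0 <= M ->
  (forall x y, `|G x - G y| <= M * `|x - y|) -> 0 < e <= pi ->
  \int[mu]_(t in `[tau + e, tau + pi]) ((G t - G tau) * hs_weight tau t) +
  \int[mu]_(t in `[tau - pi, tau - e]) ((G t - G tau) * hs_weight tau t) =
  \int[mu]_(y in `[e, pi]) ((G (tau + y) + G (tau - y) - 2 * G tau) / (1 - cos y)).
Proof.
move=> M0 GM /andP[e0 epi]; pose g t := (G t - G tau) * hs_weight tau t.
have mg : measurable_fun setT g.
  apply: measurable_funM; last exact: measurable_hs_weight.
  by apply: measurable_funB => //; exact: (measurable_lip M0 GM).
have bg t : e <= `|t - tau| <= pi -> `|g t| <= M * pi * (8 / e ^+ 2).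
  move=> h; rewrite normrM ler_pM ?hs_weight_le//.
  by rewrite (le_trans (GM _ _))// ler_wpM2l//; case/andP: h.
rewrite -[LHS]/(\int[mu]_(t in `[tau + e, tau + pi]) g t +
  \int[mu]_(t in `[tau - pi, tau - e]) g t).
rewrite (Rintegral_translation (tau + e) (tau + pi) tau mg).
rewrite (Rintegral_translation (tau - pi) (tau - e) tau mg).
rewrite [X in _ + X]Rintegral_reflection; last first.
  by apply: (measurableT_comp mg); exact: measurable_funD.
rewrite (_ : tau + e - tau = e); last by ring.
rewrite (_ : tau + pi - tau = pi); last by ring.
rewrite (_ : - (tau - e - tau) = e); last by ring.
rewrite (_ : - (tau - pi - tau) = pi); last by ring.
rewrite -RintegralD//.
- apply: eq_Rintegral => y _; rewrite /g /hs_weight !addrK cosN.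
  by rewrite -mulrDl; congr (_ / _); rewrite [- y + tau]addrC [y + tau]addrC; ring.
- apply: (bounded_integrable_itv (C := M * pi * (8 / e ^+ 2))).
    by apply: measurable_funTS; apply: (measurableT_comp mg); exact: measurable_funD.
  by move=> y /andP[ey ypi]; apply: bg; rewrite addrK ger0_norm ?ey// (le_trans _ ey)// ltW.
- apply: (bounded_integrable_itv (C := M * pi * (8 / e ^+ 2))).
    apply: measurable_funTS; apply: (measurableT_comp mg).
    by apply: measurable_funD => //; exact: measurable_funN.
  move=> y /andP[ey ypi]; apply: bg.
  by rewrite addrK normrN ger0_norm ?ey// (le_trans _ ey)// ltW.
Qed.

Lemma integrable_hs_weight (B : R -> R) (tau : R) : measurable_fun setT B ->
  (\int[mu]_(t in `[(tau - pi)%R, (tau + pi)%R]) (`|B t| * (t - tau) ^- 2)%:E < +oo)%E ->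
  mu.-integrable `[tau - pi, tau + pi] (EFin \o (fun t => B t * hs_weight tau t)).
Proof.
move=> mB Bfin; have mBw : measurable_fun setT (fun t => B t * hs_weight tau t).
  by apply: measurable_funM => //; exact: measurable_hs_weight.
have mBq : measurable_fun setT (fun t : R => `|B t| * (t - tau) ^- 2).
  apply: measurable_funM; first exact: measurableT_comp.
  by apply: measurable_funV; apply: measurable_funX; exact: measurable_funB.
have hle (t : R) : tau - pi <= t -> t <= tau + pi -> `|t - tau| <= pi.
  by move=> h1 h2; rewrite ler_norml; apply/andP; split; lra.
apply/integrableP; split; first by apply/measurable_EFinP; exact: measurable_funTS.
apply: (@le_lt_trans _ _ (8%:E *
    \int[mu]_(t in `[(tau - pi)%R, (tau + pi)%R]) (`|B t| * (t - tau) ^- 2)%:E)%E).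
  rewrite -ge0_integralZl//; last 2 first.
  - by apply/measurable_EFinP; exact: measurable_funTS.
  - by move=> t _; rewrite lee_fin mulr_ge0// invr_ge0 sqr_ge0.
  apply: ge0_le_integral => //.
  - by apply/measurable_EFinP; apply: measurableT_comp => //; exact: measurable_funTS.
  - by apply: measurable_funeM; apply/measurable_EFinP; exact: measurable_funTS.
  move=> t; rewrite /= in_itv/= => /andP[t1 t2]; rewrite -EFinM lee_fin normrM mulrCA.
  (* At t = tau both weights are the inverse of 0, hence 0. *)
  rewrite ler_wpM2l//; have [->|tt] := eqVneq t tau.
    by rewrite /hs_weight !subrr cos0 subrr !invr0 normr0 expr0n invr0 mulr0.
  have d0 : 0 < `|t - tau| by rewrite normr_gt0 subr_eq0.
  have := @hs_weight_le _ tau `|t - tau| t d0; rewrite lexx real_normK ?num_real//; apply.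
  exact: hle.
by rewrite lte_mul_pinfty.
Qed.

Lemma hs_converges_at (Phi phi G : R -> R) (C M tau : R) : 0 <= M ->
  (forall x, `|Phi x| <= C) -> (forall x, `|phi x| <= C) ->
  measurable_fun setT phi -> (forall a b, ae_modulus Phi phi a b) ->
  periodic G (2 * pi) -> (forall x y, `|G x - G y| <= M * `|x - y|) ->
  G tau = Phi tau ->
  (\int[mu]_(t in `[(tau - pi)%R, (tau + pi)%R]) (`|phi t - G t| * (t - tau) ^- 2)%:E < +oo)%E ->
  derivable Phi tau 1 -> derivable G tau 1 -> derivable (conj_fun G) tau 1 ->
  hilbert_stieltjes_converges Phi tau.
Proof.
move=> M0 PhiC phiC mphi mod pG GM Gtau Bfin dPhi dG dH.
have C0 : 0 <= C by rewrite (le_trans _ (PhiC 0)).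
have mG := measurable_lip M0 GM.
pose B t := (phi t - G t) * hs_weight tau t.
have iB : mu.-integrable `[tau - pi, tau + pi] (EFin \o B).
  by apply: integrable_hs_weight => //; exact: measurable_funB.
have iB1 : mu.-integrable `[tau, tau + pi] (EFin \o B).
  by apply: integrable_itvS iB => //; rewrite lerBlDr lerDl ltW.
have iB2 : mu.-integrable `[tau - pi, tau] (EFin \o B).
  by apply: integrable_itvS iB => //; rewrite lerDl ltW.
apply: (@hs_converges_of_weighted _ Phi phi C tau C0 PhiC phiC mphi mod
  (- 'D_1 (conj_fun G) tau + (\int[mu]_(t in `[tau, tau + pi]) B t +
    \int[mu]_(t in `[tau - pi, tau]) B t))) => //.
have lim := cvgD (sym_diff_cvg pG M0 GM dG dH)
  (cvgD (Rintegral_cvg_right pi0 iB1) (Rintegral_cvg_left pi0 iB2)).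
apply: cvg_trans (lim _ _); apply: near_eq_cvg; near=> e.
have e0 : 0 < e by near: e; exact: nbhs_right_gt.
have epi : e <= pi by near: e; exact: nbhs_right_le.
have e0pi : 0 < e <= pi by rewrite e0.
pose g t := (G t - G tau) * hs_weight tau t.
have intg a b : (forall t, a <= t <= b -> e <= `|t - tau| <= pi) ->
    mu.-integrable `[a, b] (EFin \o g).
  move=> h; apply: (bounded_integrable_itv (C := M * pi * (8 / e ^+ 2))).
    apply: measurable_funTS; apply: measurable_funM; last exact: measurable_hs_weight.
    exact: measurable_funB.
  move=> t /h ht; rewrite normrM ler_pM ?hs_weight_le//.
  by rewrite (le_trans (GM _ _))// ler_wpM2l//; case/andP: ht.
have ig1 : mu.-integrable `[tau + e, tau + pi] (EFin \o g).
  by apply: intg => t /andP[h1 h2]; rewrite ger0_norm; [apply/andP; split|]; lra.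
have ig2 : mu.-integrable `[tau - pi, tau - e] (EFin \o g).
  by apply: intg => t /andP[h1 h2]; rewrite distrC ger0_norm; [apply/andP; split|]; lra.
have iB1' : mu.-integrable `[tau + e, tau + pi] (EFin \o B).
  by apply: integrable_itvS iB1 => //; rewrite lerDl ltW.
have iB2' : mu.-integrable `[tau - pi, tau - e] (EFin \o B).
  by apply: integrable_itvS iB2 => //; rewrite lerBlDr lerDl ltW.
have split t : (phi t - Phi tau) * hs_weight tau t = g t + B t.
  by rewrite /g /B -mulrDl -Gtau; congr (_ * _); ring.
under eq_Rintegral do rewrite split.
under [X in _ = _ + X]eq_Rintegral do rewrite split.
rewrite !RintegralD// addrACA (weighted_symmetric tau M0 GM e0pi).
Unshelve. all: by end_near. Qed.

End convergence.

Unset Implicit Arguments.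

Theorem corollary7 (R : realType) (Phi : R -> R)
    (Phi_periodic : periodic Phi (2 * pi))
    (Phi_bounded : bounded_fun Phi)
    (Phi_derivable : {ae @lebesgue_measure R, forall x : R, derivable Phi x 1}) :
  {ae @lebesgue_measure R, forall tau : R, hilbert_stieltjes_converges Phi tau}.
Proof.
have [C PhiC] : exists C, forall x, `|Phi x| <= C.
  have [K [_ KP]] := Phi_bounded; exists (K + 1) => x.
  by apply: KP => //; rewrite ltrDl.
have aelip : {ae @lebesgue_measure R, forall x, exists n : nat, lip_points Phi n%:R x}.
  by apply: (lebesgue_aeS Phi_derivable) => x; exact: (derivable_lip_points PhiC).
have pi0 : 0 < pi :> R := pi_gt0 R.
suff Hn (n : nat) : {ae @lebesgue_measure R, forall x, lip_points Phi n%:R x ->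
    derivable Phi x 1 -> hilbert_stieltjes_converges Phi x}.
  have Hall : {ae @lebesgue_measure R, forall x, forall n : nat, lip_points Phi n%:R x ->
      derivable Phi x 1 -> hilbert_stieltjes_converges Phi x} by exact: ae_foralln.
  apply: (lebesgue_aeS (lebesgue_aeI (lebesgue_aeI Phi_derivable aelip) Hall)).
  by move=> x [[dx [n nx]] /(_ n nx dx)].
have [G [pG GM GPhi]] := lip_points_extension Phi_periodic n.
pose phi := lip_part Phi G.
have mG : measurable_fun setT G := measurable_lip (ler0n _ n) GM.
have mphi : measurable_fun setT phi by exact: (measurable_lip_part Phi_periodic).
have C0 : 0 <= C by rewrite (le_trans _ (PhiC 0)).
pose C' := C + (`|G 0| + 4 * n%:R).
(* [lip_sin_le] with t = x compares G x with G 0 at a cost of at most 4 n. *)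
have GC x : `|G x| <= `|G 0| + 4 * n%:R.
  rewrite (_ : G x = G 0 - (G (x - x) - G x)); last by rewrite subrr; ring.
  rewrite (le_trans (ler_normB _ _))// lerD2l.
  rewrite (le_trans (lip_sin_le pG (ler0n _ n) GM x x))// ler_piMr ?mulr_ge0//.
  exact: sin_max.
have G0 : 0 <= `|G 0| + 4 * n%:R by rewrite addr_ge0// mulr_ge0.
have phiC x : `|phi x| <= C'.
  rewrite /phi /lip_part /C'; case: ifPn => _.
    by rewrite (le_trans (PhiC x))// lerDl.
  by rewrite (le_trans (GC x))// lerDr.
have PhiC' x : `|Phi x| <= C' by rewrite (le_trans (PhiC x))// lerDl.
have mod a b : ae_modulus Phi phi a b by exact: ae_modulus_lip_part.
pose B x : R := `|phi x - G x|.
have mB : measurable_fun setT B by apply: measurableT_comp => //; exact: measurable_funB.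
(* The + 1 keeps the constant positive for n = 0, as the cut-off radius of the Marcinkiewicz
   integral divides by it. *)
have Bn x y : lip_points Phi n%:R x -> B y <= (2 * n%:R + 1) * `|y - x|.
  move=> nx; rewrite /B /phi /lip_part; case: ifPn => _; last first.
    by rewrite subrr normr0 mulr_ge0// addr_ge0// mulr_ge0.
  rewrite (_ : Phi y - G y = (Phi y - Phi x) - (G y - G x)); last by rewrite (GPhi x nx); ring.
  rewrite (le_trans (ler_normB _ _))//.
  by have := nx y; have := GM y x; have := normr_ge0 (y - x); rewrite !mulrDl; lra.
have n1 : 0 < 2 * n%:R + 1 :> R by rewrite ltr_wpDl// mulr_ge0.
have B0 y : 0 <= B y by exact: normr_ge0.
have mE : measurable (lip_points Phi n%:R : set (measurableTypeR R)).
  exact: measurable_lip_points.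
have mar := marcinkiewicz_ae pi mB B0 mE n1 Bn.
have dG := derivable_lip (ler0n _ n) GM.
have dH := derivable_conj_fun pG (ler0n _ n) GM.
apply: (lebesgue_aeS (lebesgue_aeI mar (lebesgue_aeI dG dH))).
move=> x [marx [dGx dHx]] nx dx.
exact: (hs_converges_at (ler0n _ n) PhiC' phiC mphi mod pG GM (GPhi x nx) (marx nx)).
Qed.
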